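(* Let $A$ be a $d\times d$ matrix with integer entries and non-zero determinant, with eigenvalues (counted with multiplicity) ordered so that $|\lambda_1|\le|\lambda_2|\le\dots\le|\lambda_d|$, and assume $A$ is expanding, i.e. $1<|\lambda_1|$. Let $f_A:\mathbb T^d\to\mathbb T^d$ be the induced linear endomorphism. For each $j\ge1$ let $\varphi_j:\mathbb N\to(0,1]$ and $\mathcal Z_j=\{z_j^i\}_{i=0}^\infty\subset\mathbb T^d$. Put $\underline\tau:=\sup_{j\ge1}\liminf_{n\to\infty}-\frac{\ln\varphi_j(n)}{n}$ and $\mathfrak S_\infty:=\bigcap_{j=1}^\infty\mathfrak S(f_A,\varphi_j,\mathcal Z_j,\mathbb N)$. Then $\mathfrak S_\infty$ is non-empty and $$\frac{\ln|\lambda_1|}{\ln|\lambda_1|+\underline\tau}\sum_{i=1}^d\ln|\lambda_i|\le h_{top}(f_A,\mathfrak S_\infty)\le\frac{\ln|\lambda_d|}{\ln|\lambda_d|+\underline\tau}\sum_{i=1}^d\ln|\lambda_i|,$$ $$\frac1{\ln|\lambda_d|}\frac{\ln|\lambda_1|}{\ln|\lambda_1|+\underline\tau}\sum_{i=1}^d\ln|\lambda_i|\le\dim_H\mathfrak S_\infty\le\frac1{\ln|\lambda_1|}\frac{\ln|\lambda_d|}{\ln|\lambda_d|+\underline\tau}\sum_{i=1}^d\ln|\lambda_i|.$$ In particular, if $|\lambda_1|=|\lambda_d|$, then $$h_{top}(f_A,\mathfrak S_\infty)=d\,\frac{(\ln|\lambda_d|)^2}{\ln|\lambda_d|+\underline\tau},\qquad\dim_H\mathfrak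 S_\infty=d\,\frac{\ln|\lambda_d|}{\ln|\lambda_d|+\underline\tau}.$$
   Context: $\mathbb N$ is the set of non-negative integers. $\mathbb T^d=\mathbb R^d/\mathbb Z^d$ with its standard (flat) metric, and $f_A(x)=Ax\bmod1$. When $\underline\tau=+\infty$, fractions with $\underline\tau$ in the denominator are read as $0$. Shrinking target set: for $X=\mathbb T^d$, $f=f_A$, $\mathfrak S(f,\varphi,\mathcal Z,\mathbb N):=\{x\in X: d(f^n(x),z_n)<\varphi(n)\text{ for infinitely many }n\in\mathbb N\}$; for $\mathcal Z_j=\{z_j^i\}_{i\ge0}$ the centre at time $n$ is $z_j^n$. Bowen topological entropy of a subset $Z\subseteq X$: let $B_n(x,\varepsilon,f)=\{y: d(f^i(x),f^i(y))<\varepsilon,\ 0\le i\le n-1\}$. For $s\ge0$, $M\ge 1$, $\varepsilon>0$ let $\mathcal M^s_{M,\varepsilon}(Z)=\inf\sum_i e^{-sn_i}$ over finite or countable families $\{B_{n_i}(x_i,\varepsilon,f)\}$ covering $Z$ with $x_i\in X$, $n_i\ge M$; $\mathcal M^s_\varepsilon(Z)=\lim_{M\to\infty}\mathcal M^s_{M,\varepsilon}(Z)$; $h_{top}(f,Z,\varepsilon)=\inf\{s:\mathcal M^s_\varepsilon(Z)=0\}$; $h_{top}(f,Z)=\lim_{\varepsilon\to0}h_{top}(f,Z,\varepsilon)$. $\dim_H$ is Hausdorff dimension. *)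

(* Defs.v *)
From HB Require Import structures.
From mathcomp Require Import all_boot all_order all_algebra archimedean.
From mathcomp Require Import generic_quotient ring_quotient complex.
From mathcomp Require Import ring lra zify.
From mathcomp Require Import all_classical all_reals all_analysis.

Set Implicit Arguments.
Unset Strict Implicit.
Unset Printing Implicit Defensive.

Import Order.TTheory GRing.Theory Num.Theory.
Import numFieldNormedType.Exports.
Import Quotient.Exports.

Local Open Scope classical_set_scope.
Local Open Scope ring_scope.
Local Open Scope quotient_scope.

Section EuclideanNorm.
Context {R : realType} {d : nat}.
Implicit Types u v w : 'cV[R]_d.

(* The norm that the library puts on matrices is the sup norm. *)
Definition enorm v : R := Num.sqrt (\sum_(i < d) v i 0 ^+ 2).

Lemma enorm_ge0 v : 0 <= enorm v.
Proof. exact: sqrtr_ge0. Qed.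

Lemma enorm_sqr v : enorm v ^+ 2 = \sum_(i < d) v i 0 ^+ 2.
Proof. by rewrite sqr_sqrtr// sumr_ge0// => i _; rewrite sqr_ge0. Qed.

Lemma enormN v : enorm (- v) = enorm v.
Proof. by congr Num.sqrt; apply: eq_bigr => i _; rewrite mxE sqrrN. Qed.

Lemma enorm0 : enorm 0 = 0.
Proof.
by rewrite /enorm big1 ?sqrtr0// => i _; rewrite mxE expr0n.
Qed.

Lemma coord_le_enorm v i : `|v i 0| <= enorm v.
Proof.
rewrite -sqrtr_sqr ler_sqrt; last by rewrite sumr_ge0// => j _; rewrite sqr_ge0.
by rewrite (bigD1 i)//= lerDl sumr_ge0// => j _; rewrite sqr_ge0.
Qed.

Lemma enorm_cauchy_schwarz u v :
  \sum_(i < d) u i 0 * v i 0 <= enorm u * enorm v.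
Proof.
have [v0|v0] := eqVneq (enorm v) 0.
  rewrite v0 mulr0 big1// => i _; have := coord_le_enorm v i.
  by rewrite v0 normr_le0 => /eqP ->; rewrite mulr0.
have [u0|u0] := eqVneq (enorm u) 0.
  rewrite u0 mul0r big1// => i _; have := coord_le_enorm u i.
  by rewrite u0 normr_le0 => /eqP ->; rewrite mul0r.
have up : 0 < enorm u by rewrite lt_neqAle eq_sym u0 enorm_ge0.
have vp : 0 < enorm v by rewrite lt_neqAle eq_sym v0 enorm_ge0.
have : 0 <= \sum_(i < d) (enorm v * u i 0 - enorm u * v i 0) ^+ 2.
  by rewrite sumr_ge0// => i _; rewrite sqr_ge0.
have -> : \sum_(i < d) (enorm v * u i 0 - enorm u * v i 0) ^+ 2 =
    2 * (enorm u * enorm v) * (enorm u * enorm v - \sum_(i < d) u i 0 * v i 0).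
  transitivity (enorm v ^+ 2 * (enorm u ^+ 2) + enorm u ^+ 2 * (enorm v ^+ 2)
      - 2 * (enorm u * enorm v) * \sum_(i < d) u i 0 * v i 0); last by ring.
  rewrite [X in _ * X + _]enorm_sqr [X in _ + _ * X - _]enorm_sqr.
  by rewrite !mulr_sumr -big_split/= -sumrB; apply: eq_bigr => i _; ring.
by rewrite pmulr_rge0 ?mulr_gt0// subr_ge0.
Qed.

Lemma enormD u v : enorm (u + v) <= enorm u + enorm v.
Proof.
rewrite -(@ler_pXn2r _ 2)// ?nnegrE ?addr_ge0 ?enorm_ge0//.
rewrite sqrrD !enorm_sqr.
under eq_bigr => i _ do rewrite mxE sqrrD.
by rewrite !big_split/= lerD2r lerD2l mulr2n lerD// enorm_cauchy_schwarz.
Qed.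

End EuclideanNorm.

Section IntLattice.
Context {R : realType} {d : nat}.

Definition int_lattice : {pred 'cV[R]_d} :=
  fun v => [forall i, v i 0 \is a Num.int].

Lemma int_latticeP (v : 'cV[R]_d) :
  reflect (forall i, v i 0 \is a Num.int) (v \in int_lattice).
Proof. exact: forallP. Qed.

Fact int_lattice_zmod_closed : zmod_closed int_lattice.
Proof.
split=> [|u v /int_latticeP uP /int_latticeP vP]; apply/int_latticeP => i.
  by rewrite mxE rpred0.
by rewrite !mxE rpredB.
Qed.

HB.instance Definition _ :=
  GRing.isZmodClosed.Build 'cV[R]_d int_lattice int_lattice_zmod_closed.

End IntLattice.

Definition torus (R : realType) (d : nat) : Type :=
  Quotient.quot (@int_lattice R d).

Section Torus.
Context {R : realType} {d : nat}.
Implicit Types (x y z : torus R d) (v : 'cV[R]_d).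

HB.instance Definition _ := GRing.Zmodule.on (torus R d).

Definition torus_pi v : torus R d := \pi v.

Lemma torus_piD v w : torus_pi (v + w) = torus_pi v + torus_pi w.
Proof. by rewrite /torus_pi !piE. Qed.

Lemma torus_piN v : torus_pi (- v) = - torus_pi v.
Proof. by rewrite /torus_pi !piE. Qed.

Lemma torus_pi0 : torus_pi 0 = 0.
Proof. by rewrite /torus_pi !piE. Qed.

Lemma torus_pi_repr x : torus_pi (repr x) = x.
Proof. exact: reprK. Qed.

Lemma torus_pi_eq v w :
  torus_pi v = torus_pi w <-> forall i, v i 0 - w i 0 \is a Num.int.
Proof.
split=> [/eqP|h].
  rewrite -Quotient.idealrBE => /int_latticeP h i.
  by have := h i; rewrite !mxE.
apply/eqP; rewrite -Quotient.idealrBE; apply/int_latticeP => i.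
by rewrite !mxE; exact: h.
Qed.

(* The flat metric: Euclidean distance minimised over lifts of [x] and [y]. *)
Definition torus_dist x y : R :=
  inf [set enorm v | v in [set v | torus_pi v = x - y]].

Let lifts x y := [set enorm v | v in [set v | torus_pi v = x - y]].

Let lifts_inf x y : has_inf (lifts x y).
Proof.
split; first by exists (enorm (repr (x - y))), (repr (x - y)) => //;
  exact: torus_pi_repr.
by exists 0 => _ [v _ <-]; exact: enorm_ge0.
Qed.

Lemma torus_dist_le x y v : torus_pi v = x - y -> torus_dist x y <= enorm v.
Proof. by move=> vxy; apply: (ge_inf (lifts_inf x y).2); exists v. Qed.

Lemma torus_dist_lt x y e : torus_dist x y < e ->
  exists2 v, torus_pi v = x - y & enorm v < e.
Proof. by move/(inf_lt (lifts_inf x y).1) => [_ [v vxy <-] ve]; exists v. Qed.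

Lemma torus_dist_ge0 x y : 0 <= torus_dist x y.
Proof.
apply: lb_le_inf; first exact: (lifts_inf x y).1.
by move=> _ [v _ <-]; exact: enorm_ge0.
Qed.

Let torus_distxx x : torus_dist x x = 0.
Proof.
apply/eqP; rewrite eq_le torus_dist_ge0 andbT -(@enorm0 R d).
by apply: torus_dist_le; rewrite subrr torus_pi0.
Qed.

Let torus_dist_sym x y : torus_dist x y = torus_dist y x.
Proof.
suff h a b : torus_dist a b <= torus_dist b a by apply/eqP; rewrite eq_le !h.
apply: lb_le_inf; first exact: (lifts_inf b a).1.
move=> _ [v vba <-]; rewrite -enormN; apply: torus_dist_le.
by rewrite torus_piN vba opprB.
Qed.

Let torus_dist_triangle y x z :
  torus_dist x z <= torus_dist x y + torus_dist y z.
Proof.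
apply/ler_addgt0Pl => e e0.
have e2 : 0 < e / 2 by rewrite divr_gt0.
have [v vxy ve] := torus_dist_lt (ltr_pwDr e2 (lexx (torus_dist x y))).
have [w wyz we] := torus_dist_lt (ltr_pwDr e2 (lexx (torus_dist y z))).
have : torus_dist x z <= enorm (v + w).
  by apply: torus_dist_le; rewrite torus_piD vxy wyz addrA subrK.
move/le_trans => /(_ _ (enormD v w)); lra.
Qed.

Let torus_dist_positivity x y : torus_dist x y = 0 -> x = y.
Proof.
move=> xy0.
have [v vxy v1] : exists2 v, torus_pi v = x - y & enorm v < 1 / 2.
  by apply: torus_dist_lt; rewrite xy0; lra.
suff v0 : v = 0.
  by apply/eqP; rewrite -subr_eq0 -vxy v0 torus_pi0.
apply/colP => i; rewrite mxE; apply/eqP/negPn/negP => vi0.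
have [w wxy] : exists2 w, torus_pi w = x - y & enorm w < Num.min (1 / 2) `|v i 0|.
  apply: torus_dist_lt; rewrite xy0 lt_min normr_gt0 vi0 andbT; lra.
rewrite lt_min => /andP[w1 wv].
have /torus_pi_eq/(_ i)/intrP[k vwk] : torus_pi v = torus_pi w by rewrite vxy.
have vi := coord_le_enorm v i; have wi := coord_le_enorm w i.
have : `|k%:~R| < 1 :> R.
  by rewrite -vwk; apply: (le_lt_trans (ler_normB _ _)); lra.
rewrite -intr_norm -[1]/(1%:~R) ltr_int => k1.
have k0 : k = 0 by lia.
move: vwk; rewrite k0 => /eqP; rewrite subr_eq0 => /eqP vw.
by move: wi; rewrite -vw leNgt wv.
Qed.

HB.instance Definition _ := isMetric.Build R (torus R d)
  torus_distxx torus_dist_positivity torus_dist_sym torus_dist_triangle.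

Lemma torus_mdistE x y : mdist x y = torus_dist x y.
Proof. by []. Qed.

(* The choice of the lift [repr x] is irrelevant by [torus_endoE] below. *)
Definition torus_endo (A : 'M[int]_d) x : torus R d :=
  torus_pi (map_mx intr A *m repr x).

Lemma torus_endoE (A : 'M[int]_d) v :
  torus_endo A (torus_pi v) = torus_pi (map_mx intr A *m v).
Proof.
apply/torus_pi_eq => i; rewrite !mxE -sumrB rpred_sum// => j _.
rewrite -mulrBr mxE rpredM ?intr_int//.
by move: j; apply/torus_pi_eq; rewrite torus_pi_repr.
Qed.

End Torus.

Section MetricDynamics.
Context {R : realType} {X : metricType R}.
Implicit Types (f : X -> X) (Z : set X) (s eps : R).

Definition shrinking_target f (phi : nat -> R) (z : nat -> X) : set X :=
  [set x | infinite_set [set n | mdist (iter n f x) (z n) < phi n]].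

Definition bowen_ball f (n : nat) (x : X) eps : set X :=
  [set y | forall i, (i < n)%N -> mdist (iter i f x) (iter i f y) < eps].

(* The index set [I] makes the covering families finite or countable. *)
Definition bowen_premeasure f s (M : nat) eps Z : \bar R :=
  ereal_inf [set c | exists (I : set nat) (n : nat -> nat) (x : nat -> X),
    [/\ forall i, I i -> (M <= n i)%N,
        Z `<=` \bigcup_(i in I) bowen_ball f (n i) (x i) eps &
        c = \esum_(i in I) (expR (- s * (n i)%:R))%:E]].

Definition bowen_measure f s eps Z : \bar R :=
  limn (fun M => bowen_premeasure f s M eps Z).

Definition htop_at f Z eps : \bar R :=
  ereal_inf [set s%:E | s in [set s | 0 <= s /\ bowen_measure f s eps Z = 0%E]].

Definition htop f Z : \bar R := lim (htop_at f Z eps @[eps --> 0^'+]).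

(* The supremum of an empty set is -oo; the empty set has diameter 0. *)
Definition diam (U : set X) : \bar R :=
  maxe 0%E (ereal_sup [set (mdist x y)%:E | x in U & y in U]).

(* Here 0 `^ 0 = 1. *)
Definition hausdorff_premeasure s (delta : R) Z : \bar R :=
  ereal_inf [set c | exists (I : set nat) (U : nat -> set X),
    [/\ forall i, I i -> (diam (U i) <= delta%:E)%E,
        Z `<=` \bigcup_(i in I) U i &
        c = \esum_(i in I) (diam (U i) `^ s)%E]].

Definition hausdorff_measure s Z : \bar R :=
  lim (hausdorff_premeasure s delta Z @[delta --> 0^'+]).

Definition hausdorff_dim Z : \bar R :=
  ereal_inf [set s%:E | s in [set s | 0 <= s /\ hausdorff_measure s Z = 0%E]].

End MetricDynamics.

(* Main.v *)
Require Import Defs.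
From mathcomp Require Import all_boot all_order all_algebra complex.
From mathcomp Require Import ring lra zify.
From mathcomp Require Import all_classical all_reals all_analysis.

(* Write [f] for [torus_endo A], [h = ln |det A|], and fix [a < l1] and [b > ld].
   The endomorphism is used only through these facts: every point has exactly
   [|det A|] preimages; [f] is injective at some scale; [f^N] is
   [C e^(b N)]-Lipschitz; and for all [x], [w], [N] some [y] satisfies
   [f^N y = w] and [d (f^j x) (f^j y) <= C e^(- a (N - j)) d (f^N x) w] for [j <= N].

   Upper bound: if [phi k <= e^(- sigma k)], the points hitting the [k]-th target lie
   in [|det A|^k] Bowen balls of order [k (1 + sigma / b)].

   Lower bound: along sparse times [k_i] at which [phi_j(k_i) >= e^(- sigma k_i)],
   each [j] being used infinitely often, put [N_i = k_i + l_i] with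
   [l_i] about [sigma k_i / a]. A point on the [i]-th target has
   [|det A|^(k_(i+1) - N_i)] descendants on the next one that shadow it up to time [N_i].
   All limits along this tree lie in the intersection of the targets, and counting the
   nodes of a level that meet a Bowen ball bounds the entropy from below by
   [h a / (a + sigma)].

   Bowen balls of order [n] have diameter at most [C e^(- a n)] and contain balls of
   radius [C^-1 e^(- b n)], so [htop / b <= dim <= htop / a]. *)

Set Implicit Arguments.
Unset Strict Implicit.
Unset Printing Implicit Defensive.

Import Order.TTheory GRing.Theory Num.Theory.
Import numFieldNormedType.Exports.
Import ComplexField.Normc.

Local Open Scope classical_set_scope.
Local Open Scope ring_scope.

(** * Bowen entropy *)

Section BowenEntropy.
Context {R : realType} {X : metricType R}.
Implicit Types (f : X -> X) (Z : set X) (s eps : R).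

Lemma bowen_premeasure_ge0 f s M eps Z :
  (0 <= bowen_premeasure f s M eps Z)%E.
Proof.
apply: le_ereal_inf_tmp => _ [I [n [x [_ _ ->]]]].
by apply: esum_ge0 => i _; rewrite lee_fin expR_ge0.
Qed.

Lemma bowen_premeasure_nondecreasing f s eps Z :
  nondecreasing_seq (fun M => bowen_premeasure f s M eps Z).
Proof.
move=> M N MN; apply: ereal_inf_le_tmp => c [I [n [x [nM ZB cE]]]].
by exists I, n, x; split=> // i /nM; apply: leq_trans.
Qed.

Lemma bowen_premeasure_le f s eps Z M :
  (bowen_premeasure f s M eps Z <= bowen_measure f s eps Z)%E.
Proof.
rewrite /bowen_measure (cvg_lim _ (ereal_nondecreasing_cvgn _))//; last first.
  exact: bowen_premeasure_nondecreasing.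
by apply: ereal_sup_ubound; exists M.
Qed.

(** Premeasures grow with [M], so the limit is their supremum, and it vanishes exactly when every
    premeasure is below every positive [u]. *)
Lemma bowen_measure_eq0P f s eps Z :
  bowen_measure f s eps Z = 0%E <->
  forall M u, 0 < u -> (bowen_premeasure f s M eps Z <= u%:E)%E.
Proof.
split=> [m0 M u u0|h].
  by rewrite (le_trans (bowen_premeasure_le _ _ _ _ _))// m0 lee_fin ltW.
apply/eqP; rewrite eq_le; apply/andP; split; last first.
  exact: le_trans (bowen_premeasure_ge0 f s 0 eps Z) (bowen_premeasure_le _ _ _ _ _).
rewrite /bowen_measure (cvg_lim _ (ereal_nondecreasing_cvgn _))//; last first.
  exact: bowen_premeasure_nondecreasing.
apply: ge_ereal_sup => _ [M _ <-]; apply/lee_addgt0Pr => e e0.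
by rewrite add0e h.
Qed.

Lemma bowen_measure_eq0_mono f s t eps Z : s <= t ->
  bowen_measure f s eps Z = 0%E -> bowen_measure f t eps Z = 0%E.
Proof.
move=> st /bowen_measure_eq0P m0; apply/bowen_measure_eq0P => M u u0.
apply: le_trans (m0 M u u0).
apply: le_ereal_inf_tmp => _ [I [n [x [nM ZB ->]]]].
apply: le_trans; first by apply: ereal_inf_lbound; exists I, n, x.
apply: le_esum => i _; rewrite lee_fin ler_expR ler_wpM2r//.
by rewrite lerN2.
Qed.

Lemma bowen_ball_le f n x e1 e2 : e1 <= e2 ->
  bowen_ball f n x e1 `<=` bowen_ball f n x e2.
Proof. by move=> e12 y yB i ni; exact: lt_le_trans (yB i ni) e12. Qed.

Lemma htop_at_nonincreasing f Z e1 e2 : e1 <= e2 ->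
  (htop_at f Z e2 <= htop_at f Z e1)%E.
Proof.
move=> e12; apply: ereal_inf_le_tmp => _ [s [s0 /bowen_measure_eq0P ms] <-].
exists s => //; split=> //; apply/bowen_measure_eq0P => M u u0.
apply: le_trans (ms M u u0); apply: ereal_inf_le_tmp => c [I [n [x [nM ZB cE]]]].
exists I, n, x; split=> // z /ZB[i Ii ziB]; exists i => //.
exact: bowen_ball_le ziB.
Qed.

Lemma htopE f Z : htop f Z = ereal_sup (htop_at f Z @` [set eps | 0 < eps]).
Proof.
apply: cvg_lim => //.
rewrite -[X in ereal_sup (_ @` X)](_ : [set` `]0, +oo[ ] = _); last first.
  by apply/seteqP; split=> x /=; rewrite in_itv/= andbT.
apply: nonincreasing_at_right_cvge => //.
by move=> x y _ _ xy; exact: htop_at_nonincreasing.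
Qed.

Lemma htop_at_le_htop f Z eps : 0 < eps -> (htop_at f Z eps <= htop f Z)%E.
Proof. by move=> e0; rewrite htopE; apply: ereal_sup_ubound; exists eps. Qed.

Lemma htop_ge0 f Z : (0 <= htop f Z)%E.
Proof.
apply: le_trans (htop_at_le_htop f Z (@ltr01 R)).
by apply: le_ereal_inf_tmp => _ [s [s0 _] <-]; rewrite lee_fin.
Qed.

Lemma htop_le f Z s : 0 <= s ->
  (forall eps, 0 < eps -> bowen_measure f s eps Z = 0%E) -> (htop f Z <= s%:E)%E.
Proof.
move=> s0 h; rewrite htopE; apply: ge_ereal_sup => _ [eps /= e0 <-].
by apply: ereal_inf_lbound; exists s => //; split=> //; exact: h.
Qed.

(** One scale suffices: [htop] is the supremum of [htop_at] over all scales. *)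
Lemma htop_ge f Z s eps : 0 < eps ->
  (forall t, 0 <= t -> t < s -> bowen_measure f t eps Z <> 0%E) ->
  (s%:E <= htop f Z)%E.
Proof.
move=> e0 h; apply: le_trans (htop_at_le_htop f Z e0).
apply: le_ereal_inf_tmp => _ [t [t0 mt0] <-]; rewrite lee_fin leNgt.
by apply/negP => /(h t t0).
Qed.

Lemma htop_gt_bowen_measure f Z s eps : 0 < eps -> (htop f Z < s%:E)%E ->
  bowen_measure f s eps Z = 0%E.
Proof.
move=> e0 /(le_lt_trans (htop_at_le_htop f Z e0)) /ereal_inf_lt[_ [t [t0 mt] <-]].
by rewrite lte_fin => /ltW ts; exact: bowen_measure_eq0_mono mt.
Qed.

(** Serves both upper bounds on entropy, where covers come as finite lists [C k] of centres sharing
    the order [m k]. Pairs (list, position) are coded as natural numbers to match the index set of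
    the premeasure. *)
Lemma bowen_premeasure_le_series (x0 : X) f s M eps Z (C : nat -> seq X) (m : nat -> nat) (u : R) :
  (forall k y, y \in C k -> (M <= m k)%N) ->
  (forall z, Z z -> exists k y, y \in C k /\ bowen_ball f (m k) y eps z) ->
  (forall N, \sum_(k < N) (size (C k))%:R * expR (- s * (m k)%:R) <= u) ->
  (bowen_premeasure f s M eps Z <= u%:E)%E.
Proof.
move=> Cm ZC Cu.
(* The default is taken only at numbers that are not codes, and [I] contains none. *)
pose dec (i : nat) : nat * nat := odflt (0, 0)%N (unpickle i).
have decK p : dec (pickle p) = p by rewrite /dec pickleK.
pose J : set (nat * nat) := setT `*`` (fun k => `I_(size (C k))).
pose I := pickle @` J.
pose x i := nth x0 (C (dec i).1) (dec i).2.
apply: le_trans.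
  apply: ereal_inf_lbound; exists I, (fun i => m (dec i).1), x; split=> //.
    move=> _ [[k l] [_ /= kl] <-]; rewrite decK/=.
    by apply: (Cm k (nth x0 (C k) l)); rewrite mem_nth.
  move=> z /ZC[k [y [yC yz]]]; exists (pickle (k, index y (C k))).
    by exists (k, index y (C k)) => //; split=> //=; rewrite index_mem.
  by rewrite /x decK/= nth_index.
rewrite (@reindex_esum R _ _ J I pickle (fun i => (expR (- s * (m (dec i).1)%:R))%:E)); last first.
  by split=> [p Jp|p q _ _|//]; [exists p|exact: (pcan_inj pickleK)].
under eq_esum do rewrite decK.
rewrite -(esum_esum (a := fun k _ => (expR (- s * (m k)%:R))%:E)); last first.
  by move=> *; rewrite lee_fin expR_ge0.
rewrite -nneseries_esumT; last first.
  by move=> k; apply: esum_ge0 => *; rewrite lee_fin expR_ge0.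
apply: lime_le.
  by apply: is_cvg_nneseries => k _ _; apply: esum_ge0 => *; rewrite lee_fin expR_ge0.
apply: nearW => N; apply: le_trans (_ : (\sum_(k < N) (size (C k))%:R * expR (- s * (m k)%:R))%:E <= _)%E; last by rewrite lee_fin.
rewrite big_mkord -sumEFin; apply: lee_sum => k _.
rewrite esum_fset; [|exact: finite_II|by move=> *; rewrite lee_fin expR_ge0].
rewrite fsumEFin; last exact: finite_II.
rewrite lee_fin.
by rewrite -fsbig_ord sumr_const card_ord mulr_natl.
Qed.

End BowenEntropy.

(** * Hausdorff dimension *)

Lemma expR_decay (R : realType) (a C d : R) : 0 < a -> 0 < C -> 0 < d ->
  exists M : nat, forall n, (M <= n)%N -> C * expR (- a * n%:R) <= d.
Proof.
move=> a0 C0 d0; exists (Num.bound `|ln (d / C) / a|) => n Mn.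
rewrite -ler_pdivlMl// [leRHS]mulrC -[leRHS](@lnK R) ?posrE ?divr_gt0// ler_expR.
have -> : - a * n%:R = - (n%:R * a) by ring.
rewrite lerNl -ler_pdivrMr// mulNr.
apply: le_trans (_ : (Num.bound `|ln (d / C) / a|)%:R <= _); last by rewrite ler_nat.
apply: le_trans (ler_norm _) _; rewrite normrN.
exact: ltW (archi_boundP (normr_ge0 _)).
Qed.

(** The individual errors form a geometric series whose full sum is [rho]. *)
Lemma le_esum_affine (R : realType) (I : set nat) (a b : nat -> \bar R)
    (K rho : R) : 0 <= K -> 0 <= rho -> (forall i, 0 <= a i)%E ->
  (forall i, I i -> b i <= K%:E * a i + (rho / (2 ^ i.+1)%:R)%:E)%E ->
  (\esum_(i in I) b i <= K%:E * (\esum_(i in I) a i) + rho%:E)%E.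
Proof.
move=> K0 rho0 a0 ab.
have IE : I = [set x | x \in I] by apply/seteqP; split=> x; rewrite /= inE.
have Ka0 n : (0 <= K%:E * a n)%E by rewrite mule_ge0.
apply: le_trans (le_esum ab) _; rewrite IE.
rewrite -[X in (X <= _)%E]nneseries_esum; last first.
  by move=> n _; rewrite adde_ge0// lee_fin divr_ge0.
rewrite -nneseries_esum// -nneseriesZl//.
exact: (epsilon_trick (A := fun i => (K%:E * a i)%E)).
Qed.

Section HausdorffDimension.
Context {R : realType} {X : metricType R}.
Implicit Types (f : X -> X) (Z : set X) (s t eps delta : R).

Lemma diam_ge0 (U : set X) : (0 <= diam U)%E.
Proof. by rewrite /diam le_max lexx. Qed.

Lemma diam_le (U : set X) (r : R) : 0 <= r ->
  (forall x y, U x -> U y -> mdist x y <= r) -> (diam U <= r%:E)%E.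
Proof.
move=> r0 h; rewrite /diam ge_max lee_fin r0/=.
by apply: ge_ereal_sup => _ [x Ux [y Uy <-]]; rewrite lee_fin h.
Qed.

Lemma mdist_le_diam (U : set X) (x y : X) (r : R) :
  U x -> U y -> (diam U <= r%:E)%E -> mdist x y <= r.
Proof.
move=> Ux Uy; rewrite /diam ge_max => /andP[_] h; rewrite -lee_fin.
by apply: le_trans h; apply: ereal_sup_ubound; exists x => //; exists y.
Qed.

Lemma hausdorff_premeasure_ge0 s delta Z :
  (0 <= hausdorff_premeasure s delta Z)%E.
Proof.
apply: le_ereal_inf_tmp => _ [I [U [_ _ ->]]].
by apply: esum_ge0 => i _; exact: poweR_ge0.
Qed.

Lemma hausdorff_premeasure_nonincreasing s Z d1 d2 : d1 <= d2 ->
  (hausdorff_premeasure s d2 Z <= hausdorff_premeasure s d1 Z)%E.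
Proof.
move=> d12; apply: ereal_inf_le_tmp => c [I [U [dU ZU cE]]].
by exists I, U; split=> // i /dU/le_trans; apply; rewrite lee_fin.
Qed.

Lemma hausdorff_measureE s Z : hausdorff_measure s Z =
  ereal_sup [set hausdorff_premeasure s delta Z | delta in [set d | 0 < d]].
Proof.
apply: cvg_lim => //.
rewrite -[X in ereal_sup (_ @` X)](_ : [set` `]0, +oo[ ] = _); last first.
  by apply/seteqP; split=> x /=; rewrite in_itv/= andbT.
apply: (nonincreasing_at_right_cvge (f := fun d => hausdorff_premeasure s d Z)) => //.
by move=> x y _ _ xy; exact: hausdorff_premeasure_nonincreasing.
Qed.

Lemma hausdorff_measure_eq0P s Z :
  hausdorff_measure s Z = 0%E <->
  forall delta u, 0 < delta -> 0 < u ->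
    (hausdorff_premeasure s delta Z <= u%:E)%E.
Proof.
rewrite hausdorff_measureE; split=> [m0 d u d0 u0|h].
  apply: (@le_trans _ _ 0%E); last by rewrite lee_fin ltW.
  by rewrite -m0; apply: ereal_sup_ubound; exists d.
apply/eqP; rewrite eq_le; apply/andP; split.
  apply: ge_ereal_sup => _ [d d0 <-]; apply/lee_addgt0Pr => e e0.
  by rewrite add0e h.
apply: le_trans (hausdorff_premeasure_ge0 s 1 Z) _.
by apply: ereal_sup_ubound; exists 1 => /=.
Qed.

Lemma hausdorff_dim_ge0 Z : (0 <= hausdorff_dim Z)%E.
Proof. by apply: le_ereal_inf_tmp => _ [s [s0 _] <-]; rewrite lee_fin. Qed.

(** A cover by Bowen balls is itself a cover by small sets, and a diameter [C * expR (- a * n)]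
    raised to the power [s / a] is the Bowen weight [expR (- s * n)] up to the constant [K]. *)
Lemma hausdorff_dim_le_htop f Z (C a eps s : R) :
  0 < a -> 0 < eps -> 0 < C ->
  (forall n x y y', bowen_ball f n x eps y -> bowen_ball f n x eps y' ->
     mdist y y' <= C * expR (- a * n%:R)) ->
  (htop f Z < s%:E)%E -> (hausdorff_dim Z <= (s / a)%:E)%E.
Proof.
move=> a0 e0 C0 contr hs.
have s0 : 0 < s by rewrite -lte_fin (le_lt_trans (htop_ge0 f Z)).
have t0 : 0 < s / a by rewrite divr_gt0.
apply: ereal_inf_lbound; exists (s / a) => //; split; first exact: ltW.
apply/hausdorff_measure_eq0P => d u d0 u0.
have [M Md] : exists M, C * expR (- a * M%:R) <= d.
  have [M hM] := expR_decay a0 C0 d0; exists M; exact: hM.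
have := htop_gt_bowen_measure e0 hs.
pose K := C `^ (s / a).
have K0 : 0 < K by rewrite powR_gt0.
move=> /bowen_measure_eq0P/(_ M (u / K / 2)).
have uK : 0 < u / K by rewrite divr_gt0.
move=> /(_ ltac:(by rewrite divr_gt0)) bm.
have /ereal_inf_lt[_ [I [n [x [nM ZB ->]]]]] :
   (bowen_premeasure f s M eps Z < (u / K)%:E)%E.
  by apply: le_lt_trans bm _; rewrite lte_fin ltr_pdivrMr// mulr2n; lra.
move=> lu.
apply: le_trans.
  apply: ereal_inf_lbound; exists I, (fun i => bowen_ball f (n i) (x i) eps); split=> //.
  move=> i /nM Mn; apply: diam_le => [|y y' By By']; first exact: ltW.
  apply: le_trans (contr _ _ _ _ By By') (le_trans _ Md).
  by rewrite ler_pM2l// ler_expR !mulNr lerN2 ler_pM2l// ler_nat.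
apply: le_trans (_ : K%:E * (\esum_(i in I) (expR (- s * (n i)%:R))%:E) + 0%:E <= _)%E; last first.
  rewrite adde0; apply: le_trans (lee_wpmul2l _ (ltW lu)) _; first by rewrite lee_fin ltW.
  by rewrite -EFinM lee_fin mulrC divfK// gt_eqF.
apply: le_esum_affine; [exact: ltW|by []|by move=> i; rewrite lee_fin expR_ge0|].
move=> i Ii; rewrite mul0r adde0 -EFinM.
have dU := diam_le (mulr_ge0 (ltW C0) (expR_ge0 (- a * (n i)%:R))) (@contr (n i) (x i)).
apply: le_trans (gt0_ler_poweR (ltW t0) _ _ dU) _.
- by rewrite in_itv/= diam_ge0 leey.
- by rewrite in_itv/= lee_fin leey mulr_ge0// ?expR_ge0// ltW.
rewrite poweR_EFin lee_fin powRM ?expR_ge0 ?(ltW C0)// -expRM.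
rewrite ler_pM2l// ler_expR (_ : _ * (s / a) = - s * (n i)%:R)//.
by field; rewrite gt_eqF.
Qed.

(** With [r] the diameter, take the least [n] such that [eps * expR (- b * n) <= C * r]. Minimality
    keeps the images of [U] within [eps] before time [n], the inequality at [n] compares the Bowen
    weight with [r] to the power [t], and the choice of [delta] forces [M <= n]. *)
Lemma small_set_in_bowen_ball f (C b eps s t : R) (M : nat) :
  0 < b -> 0 < eps -> 0 < C -> 0 <= t -> b * t <= s -> 0 < s ->
  (forall N x y,
     mdist (iter N f x) (iter N f y) <= C * expR (b * N%:R) * mdist x y) ->
  exists2 delta, 0 < delta & forall (U : set X) x rho,
    U x -> (diam U <= delta%:E)%E -> 0 < rho ->
    exists n, [/\ (M <= n)%N, U `<=` bowen_ball f n x eps &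
      ((expR (- s * n%:R))%:E <= ((C / eps) `^ t)%:E * diam U `^ t + rho%:E)%E].
Proof.
move=> b0 e0 C0 t0 bts s0 lip.
exists (eps * expR (- b * M%:R) / (2 * C)).
  by rewrite divr_gt0 ?mulr_gt0 ?expR_gt0.
move=> U x rho Ux; set delta := _ / _ => dU rho0.
have [r r0 rE] : exists2 r, 0 <= r & diam U = r%:E.
  move: dU (diam_ge0 U); case: (diam U) => [r|//|//] _; rewrite lee_fin => r0.
  by exists r.
have dr y : U y -> mdist x y <= r.
  by move=> Uy; apply: (mdist_le_diam Ux Uy); rewrite rE.
(* A set of diameter zero lies in Bowen balls of every order, so the order is taken large enough for
   the weight to be at most [rho]. *)
have [r_eq0|r_neq0] := eqVneq r 0.
  have [N hN] := expR_decay s0 ltr01 rho0.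
  exists (maxn M N); split; first exact: leq_maxl.
    move=> y Uy i _; apply: le_lt_trans (lip i x y) _.
    have -> : mdist x y = 0 by apply/eqP; rewrite eq_le mdist_ge0 -r_eq0 dr.
    by rewrite mulr0.
  rewrite -[X in (X <= _)%E]add0e leeD//; first by rewrite mule_ge0 ?poweR_ge0 ?lee_fin ?powR_ge0.
  by rewrite lee_fin -[X in X <= _]mul1r hN// leq_maxr.
have rp : 0 < r by rewrite lt_neqAle eq_sym r_neq0.
have exQ : exists n : nat, eps * expR (- b * n%:R) <= C * r.
  have [N hN] := expR_decay b0 e0 (mulr_gt0 C0 rp).
  by exists N; exact: hN.
have [n Qn minn] := ex_minnP exQ.
have notQ i : (i < n)%N -> C * r < eps * expR (- b * i%:R).
  by move=> ni; rewrite ltNge; apply/negP => /minn; rewrite leqNgt ni.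
exists n; split.
- rewrite leqNgt; apply/negP => nM.
  have : C * r < eps * expR (- b * n%:R); last by rewrite ltNge Qn.
  apply: le_lt_trans (_ : C * delta < _).
    by rewrite ler_pM2l// -lee_fin -rE.
  apply: lt_le_trans (_ : eps * expR (- b * M%:R) <= _).
    rewrite (_ : C * delta = eps * expR (- b * M%:R) / 2).
      by rewrite ltr_pdivrMr// ltr_pMr ?mulr_gt0 ?expR_gt0// ltr1n.
    by rewrite /delta; field; rewrite gt_eqF.
  by rewrite ler_pM2l// ler_expR !mulNr lerN2 ler_pM2l// ler_nat ltnW.
- move=> y Uy i ni; apply: le_lt_trans (lip i x y) _.
  apply: le_lt_trans (_ : C * r * expR (b * i%:R) < _).
    by rewrite [leRHS]mulrAC ler_pM2l ?mulr_gt0 ?expR_gt0// dr.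
  have := notQ i ni; rewrite -ltr_pdivrMr ?expR_gt0// mulNr expRN invrK.
  by rewrite mulrC.
- apply: le_trans (_ : ((C / eps) `^ t)%:E * diam U `^ t <= _)%E; last first.
    by rewrite leeDl// lee_fin ltW.
  rewrite rE poweR_EFin -EFinM lee_fin -powRM ?divr_ge0 ?(ltW e0) ?(ltW C0)//.
  apply: le_trans (_ : expR (- b * n%:R) `^ t <= _).
    by rewrite -expRM ler_expR !mulNr lerN2 [leLHS]mulrAC ler_wpM2r.
  apply: ge0_ler_powR; rewrite ?nnegrE ?expR_ge0 ?mulr_ge0 ?divr_ge0 ?invr_ge0 ?(ltW e0) ?(ltW C0)//.
  by rewrite mulrAC ler_pdivlMr// mulrC.
Qed.

Lemma htop_le_hausdorff_dim (x0 : X) f Z (C b t : R) : 0 < b -> 0 < C ->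
  (forall N x y,
     mdist (iter N f x) (iter N f y) <= C * expR (b * N%:R) * mdist x y) ->
  (hausdorff_dim Z < t%:E)%E -> (htop f Z <= (b * t)%:E)%E.
Proof.
move=> b0 C0 lip /ereal_inf_lt[_ [t' [t'0 /hausdorff_measure_eq0P mt'] <-]].
rewrite lte_fin => t't.
have t0 : 0 < t by exact: le_lt_trans t't.
apply: htop_le => [|eps e0]; first by rewrite mulr_ge0// ltW.
apply/bowen_measure_eq0P => M u u0.
have bts : b * t' <= b * t by rewrite ler_pM2l// ltW.
have [delta d0 hd] := small_set_in_bowen_ball M b0 e0 C0 t'0 bts (mulr_gt0 b0 t0) lip.
pose K := (C / eps) `^ t'.
have K0 : 0 < K by apply: powR_gt0; apply: divr_gt0.
(* Half of [u] pays for the diameters, the other half for the errors [rho] summed over the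
   pieces. *)
pose v := u / 2 / K.
have v0 : 0 < v by apply: divr_gt0 => //; apply: divr_gt0.
have [_ [I [U [dU ZU ->]]] lv] : exists2 c, [set c | exists (I : set nat) (U : nat -> set X),
    [/\ forall i, I i -> (diam (U i) <= delta%:E)%E,
        Z `<=` \bigcup_(i in I) U i &
        c = \esum_(i in I) (diam (U i) `^ t')%E]] c & (c < v%:E)%E.
  have h2 : (hausdorff_premeasure t' delta Z < v%:E)%E.
    apply: le_lt_trans (mt' delta (v / 2) d0 (divr_gt0 v0 (ltr0Sn _ _))) _.
    by rewrite lte_fin ltr_pdivrMr// ltr_pMr// ltr1n.
  by have /ereal_inf_lt[c hc lc] := h2; exists c.
(* Each Bowen ball is centred at a point of its piece, so empty pieces are discarded. *)
pose J := [set i | I i /\ U i !=set0].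
have pick i : {p : nat * X | J i -> [/\ (M <= p.1)%N,
    U i `<=` bowen_ball f p.1 p.2 eps &
    ((expR (- (b * t) * p.1%:R))%:E <=
      K%:E * diam (U i) `^ t' + (u / 2 / (2 ^ i.+1)%:R)%:E)%E]}.
  apply: cid.
  have [Ji|nJi] := pselect (J i); last first.
    by exists (0%N, x0).
  have [x Ux] := Ji.2.
  have [|n [Mn Un en]] := hd (U i) x (u / 2 / (2 ^ i.+1)%:R) Ux (dU i Ji.1).
    by rewrite !divr_gt0// ltr0n expn_gt0.
  by exists (n, x) => _; split.
apply: le_trans.
  apply: ereal_inf_lbound.
  exists J, (fun i => (projT1 (pick i)).1), (fun i => (projT1 (pick i)).2); split=> //.
  - by move=> i Ji; have [] := projT2 (pick i) Ji.
  - move=> z /[dup] Zz /ZU[i Ii Uz]; exists i; first by split=> //; exists z.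
    have Ji : J i by split=> //; exists z.
    by have [_ + _] := projT2 (pick i) Ji; apply.
apply: le_trans (le_esum_affine (K := K) (rho := u / 2) (a := fun i => (diam (U i) `^ t')%E) _ _ _ _) _.
- exact: ltW.
- by rewrite divr_ge0// ltW.
- by move=> i; exact: poweR_ge0.
- by move=> i Ji; have [_ _ ] := projT2 (pick i) Ji.
have uE : u%:E = (K%:E * v%:E + (u / 2)%:E)%E.
  by rewrite -EFinM -EFinD; congr EFin; rewrite /v; field; rewrite gt_eqF.
rewrite uE leeD2r// lee_wpmul2l ?lee_fin ?(ltW K0)//; apply: le_trans (ltW lv).
apply: ge_ereal_sup => _ [F [finF FJ] <-].
by apply: esum_ge; exists F => //; split=> // i /FJ[].
Qed.
End HausdorffDimension.

(** * Upper bounds for entropy *)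

Section ExpandingSystems.
Context {R : realType} {X : metricType R}.
Implicit Types (f : X -> X) (Z : set X).

Definition has_degree f (D : nat) := forall z : X,
  exists s : seq X, [/\ uniq s, size s = D & forall x, (x \in s) = (f x == z)].

Definition injective_at_scale f (delta : R) := forall x y : X,
  mdist x y < delta -> f x = f y -> x = y.

(** The bound involves any [r] strictly above the distance: the toral distance is an infimum over
    lifts, and such an [r] bounds the norm of an actual lift. *)
Definition backward_contracting f (a C : R) := forall N (x w : X) r,
  mdist (iter N f x) w < r -> exists2 y, iter N f y = w &
    forall j, (j <= N)%N ->
      mdist (iter j f x) (iter j f y) <= C * expR (- a * (N - j)%:R) * r.

Definition forward_expanding f (b C : R) := forall N (x y : X),
  mdist (iter N f x) (iter N f y) <= C * expR (b * N%:R) * mdist x y.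

Lemma has_degree_iter f D m : has_degree f D -> has_degree (iter m f) (D ^ m).
Proof.
move=> fD; elim: m => [|m IHm] z.
  by exists [:: z]; split=> // x; rewrite inE.
have [s [us ss ms]] := fD z.
have [t tP] := choice IHm.
exists [seq x | y <- s, x <- t y]; split.
- apply: allpairs_uniq_dep => //; first by move=> y _; have [] := tP y.
  move=> _ _ /allpairsPdep[y [x [ys xt ->]]] /allpairsPdep[y' [x' [ys' xt' ->]]] /= xx'.
  move: xt xt'; rewrite -{}xx'; have [_ _ ->] := tP y; have [_ _ ->] := tP y'.
  by move=> /eqP <- /eqP ->.
- rewrite size_allpairs_dep (eq_map (g := fun=> (D ^ m)%N)); last first.
    by move=> y; have [] := tP y.
  by rewrite sumnE big_map big_const_seq count_predT iter_addn_0 ss mulnC expnS.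
- move=> x; rewrite iterS -ms; apply/allpairsPdep/idP => [[y [x' [ys + ->]]]|xs].
    by have [_ _ ->] := tP y => /eqP ->.
  exists (iter m f x), x; split=> //.
  by have [_ _ ->] := tP (iter m f x).
Qed.

Lemma infinite_set_ge (A : set nat) (K : nat) : infinite_set A ->
  exists2 n, A n & (K <= n)%N.
Proof.
move=> Ainf; apply: contrapT => nA; apply: Ainf.
apply: sub_finite_set (finite_II K) => n An /=.
by rewrite ltnNge; apply/negP => Kn; apply: nA; exists n.
Qed.

Lemma geometric_tail_le (q : R) (K N : nat) : 0 <= q -> q < 1 ->
  \sum_(k < N) (if (K <= k)%N then q ^+ k else 0) <= q ^+ K / (1 - q).
Proof.
move=> q0 q1; have q1' : 0 < 1 - q by rewrite subr_gt0.
rewrite ler_pdivlMr//.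
(* Multiplication by [1 - q] makes the sum telescope. *)
suff : (\sum_(k < N) (if (K <= k)%N then q ^+ k else 0)) * (1 - q) <=
    (if (K <= N)%N then q ^+ K - q ^+ N else 0).
  move=> /le_trans; apply; case: ifP => _; last exact: exprn_ge0.
  by rewrite gerBl exprn_ge0.
elim: N => [|N IHN].
  by rewrite big_ord0 mul0r; case: ifP => //; rewrite leqn0 => /eqP ->; rewrite subrr.
rewrite big_ord_recr/= mulrDl; case: ifPn => KN.
  rewrite leqW// KN in IHN *; rewrite exprS.
  have -> : q ^+ K - q * q ^+ N = (q ^+ K - q ^+ N) + q ^+ N * (1 - q) by ring.
  by rewrite lerD2r.
move: IHN; rewrite (negbTE KN) mul0r addr0 => /le_trans; apply.
by case: ifP => //; rewrite leq_eqVlt ltnS (negbTE KN) orbF => /eqP ->; rewrite subrr.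
Qed.

(** Every point is shadowed by a preimage of [x0] under the iterate of order [n + q]. The [q] extra
    steps contract the initial error [r0] below [eps], so [D ^ (n + q)] Bowen balls of order [n]
    cover everything. *)
Lemma htop_le_ln_degree (x0 : X) f D (a C r0 s : R) Z : (0 < D)%N ->
  has_degree f D -> 0 < a -> 0 < C -> backward_contracting f a C ->
  0 < r0 -> (forall x y : X, mdist x y < r0) -> ln D%:R < s ->
  (htop f Z <= s%:E)%E.
Proof.
move=> D0 fD a0 C0 fC r00 fr0 Ds.
have s0 : 0 <= s by apply: le_trans (ltW Ds); rewrite ln_ge0// ler1n.
have DR : 0 < D%:R :> R by rewrite ltr0n.
apply: htop_le => // eps e0; apply/bowen_measure_eq0P => M u u0.
have [q qP] := @expR_decay R a (C * r0) (eps / 2) a0 (mulr_gt0 C0 r00) (divr_gt0 e0 (ltr0Sn _ _)).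
have Ds0 : 0 < s - ln D%:R by rewrite subr_gt0.
have [n0 n0P] := @expR_decay R (s - ln D%:R) (D%:R ^+ q) u Ds0 (exprn_gt0 _ DR) u0.
pose n := maxn M n0.
have [t [ut st mt]] := has_degree_iter (n + q) fD x0.
(* A single finite family is used, placed at index 0. *)
apply: (bowen_premeasure_le_series x0 (C := fun k => if k == 0%N then t else [::]) (m := fun=> n)).
- by move=> *; exact: leq_maxl.
- move=> x _; exists 0%N.
  have [y ynq xy] := fC (n + q)%N x x0 r0 (fr0 _ _); exists y; split.
    by rewrite eqxx mt ynq.
  move=> j jn; rewrite metric_sym; apply: le_lt_trans (xy j (ltnW (ltn_addr q jn))) _.
  apply: le_lt_trans (_ : eps / 2 < _); last by lra.
  by rewrite mulrAC; apply: qP; rewrite addnC -addnBA ?leq_addr// ltnW.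
- case=> [|N]; first by rewrite big_ord0 ltW.
  rewrite big_ord_recl/= big1 ?addr0; last by move=> i _; rewrite mul0r.
  rewrite st; apply: le_trans (n0P n (leq_maxr _ _)).
  have -> : (D ^ (n + q))%:R = D%:R ^+ q * expR (n%:R * ln D%:R) :> R.
    by rewrite natrX exprD expRM_natl lnK ?posrE// mulrC.
  by rewrite -mulrA -expRD (_ : _ + _ = - (s - ln D%:R) * n%:R)//; ring.
Qed.

(** A point hitting the target at time [k] is shadowed up to [k] by one of the [D ^ k] preimages of
    [z k]. Afterwards the error, at most of order [expR (- sigma * k)], grows at rate [b], hence
    stays below [eps] for about [sigma * k / b] more steps. The total weight is the tail of a
    geometric series. *)
Lemma htop_shrinking_le (x0 : X) f D (a C b C' sigma s : R) phi z Z (K0 : nat) :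
  (0 < D)%N -> has_degree f D -> 0 < a -> 0 < C -> backward_contracting f a C ->
  0 < b -> 0 < C' -> forward_expanding f b C' -> 0 < sigma ->
  Z `<=` shrinking_target f phi z ->
  (forall k, (K0 <= k)%N -> phi k <= expR (- sigma * k%:R)) ->
  0 <= s -> ln D%:R < s * (1 + sigma / b) -> (htop f Z <= s%:E)%E.
Proof.
move=> D0 fD a0 C0 fC b0 C'0 fb sg0 ZS phiK s0 Ds.
have DR : 0 < D%:R :> R by rewrite ltr0n.
apply: htop_le => // eps e0; apply/bowen_measure_eq0P => M u u0.
(* [CC] dominates the constants of both the shadowing and the expanding phase, and [c] is chosen so
   that [CC * expR (- c)] is [eps / 2]. *)
pose CC := C * (1 + C').
have CC0 : 0 < CC by rewrite mulr_gt0// addr_gt0.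
pose c := ln (2 * CC / eps).
have ec : expR c = 2 * CC / eps by rewrite lnK// posrE divr_gt0// mulr_gt0.
(* The quotient can be negative for small [k], whence the threshold [K1] in [lle]; the bound [lgt]
   holds for all [k]. *)
pose l (k : nat) : nat := Num.truncn ((sigma * k%:R - c) / b).
have [fibs fibsP] := choice (fun k => has_degree_iter k fD (z k)).
have [K1 K1P] := @expR_decay R sigma (expR c) 1 sg0 (expR_gt0 _) ltr01.
have lle k : (K1 <= k)%N -> b * (l k)%:R <= sigma * k%:R - c.
  move=> /K1P; rewrite -expRD expR_le1 => h.
  rewrite mulrC -ler_pdivlMr// truncn_le.
  by rewrite divr_ge0 ?(ltW b0)//; lra.
have lgt k : sigma * k%:R - c < b * ((l k)%:R + 1).
  by rewrite [ltRHS]mulrC -ltr_pdivrMr// natr1; exact: truncnS_gt.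
(* Ratio of the geometric series; [B] absorbs [c] and the rounding in [l]. *)
pose q := expR (ln D%:R - s * (1 + sigma / b)).
have q0 : 0 < q by rewrite expR_gt0.
have q1 : q < 1 by rewrite -expR0 ltr_expR subr_lt0.
pose B := expR (s * (1 + c / b)).
have termle k : (D ^ k)%:R * expR (- s * (k + l k)%:R) <= B * q ^+ k.
  have -> : (D ^ k)%:R = expR (k%:R * ln D%:R) :> R.
    by rewrite natrX expRM_natl lnK ?posrE.
  rewrite -expRM_natl -!expRD ler_expR.
  have h : s * ((sigma * k%:R - c) / b) <= s * ((l k)%:R + 1).
    by rewrite ler_wpM2l// ler_pdivrMr// [leRHS]mulrC ltW.
  by rewrite natrD; lra.
have Bq0 : 0 < B / (1 - q) by rewrite divr_gt0 ?expR_gt0// subr_gt0.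
have a'0 : 0 < s * (1 + sigma / b) - ln D%:R by rewrite subr_gt0.
have [K2 K2P] := @expR_decay R _ _ u a'0 Bq0 u0.
pose K := maxn (maxn K0 K1) (maxn K2 M).
have /andP[/andP[K0K K1K] /andP[K2K MK]] :
    (K0 <= K)%N && (K1 <= K)%N && ((K2 <= K)%N && (M <= K)%N).
  by rewrite -!geq_max.
apply: (bowen_premeasure_le_series x0 (C := fun k => if (K <= k)%N then fibs k else [::]) (m := fun k => (k + l k)%N)).
- move=> k y; case: ifP => // Kk _; exact: leq_trans (leq_trans MK Kk) (leq_addr _ _).
- move=> x /ZS /(infinite_set_ge K)[k xk Kk]; exists k; rewrite Kk.
  have [y yk xy] := fC k x (z k) _ (lt_le_trans xk (phiK k (leq_trans K0K Kk))).
  exists y; split; first by have [_ _ ->] := fibsP k; rewrite yk.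
  have small i : (i <= l k)%N -> CC * expR (b * i%:R) * expR (- sigma * k%:R) < eps.
    move=> il; apply: le_lt_trans (_ : eps / 2 < _); last by lra.
    have -> : eps / 2 = CC * expR (- c).
      by rewrite expRN ec; field; rewrite !gt_eqF.
    rewrite -mulrA ler_pM2l// -expRD ler_expR.
    have := lle k (leq_trans K1K Kk); have : b * i%:R <= b * (l k)%:R by rewrite ler_pM2l// ler_nat.
    by lra.
  move=> j jm; rewrite metric_sym; have [jk|kj] := leqP j k.
    apply: le_lt_trans (xy j jk) _; apply: le_lt_trans (small 0%N isT).
    rewrite mulr0 expR0 mulr1 ler_pM2r ?expR_gt0// /CC ler_pM2l//.
    rewrite ler_wpDr ?(ltW C'0)// expR_le1 mulNr oppr_le0 mulr_ge0// ltW//.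
  rewrite -(subnK (ltnW kj)) !iterD; apply: le_lt_trans (fb _ _ _) _.
  apply: le_lt_trans (small (j - k)%N _); last by rewrite leq_subLR ltnW.
  have := xy k (leqnn k); rewrite subnn mulr0 expR0 mulr1 => h.
  apply: le_trans (ler_wpM2l _ h) _; first by rewrite mulr_ge0 ?expR_ge0 ?ltW.
  rewrite /CC mulrA ler_pM2r ?expR_gt0// mulrAC ler_pM2r ?expR_gt0//.
  by rewrite mulrC ler_pM2l// lerDr.
- move=> N; apply: le_trans (_ : B * (\sum_(k < N) (if (K <= k)%N then q ^+ k else 0)) <= _).
    rewrite mulr_sumr; apply: ler_sum => k _; case: ifP => _; last by rewrite mul0r mulr0.
    by have [_ -> _] := fibsP k; exact: termle.
  apply: le_trans (ler_wpM2l (expR_ge0 _) (geometric_tail_le K N (ltW q0) q1)) _.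
  rewrite mulrA mulrAC -expRM_natr; apply: le_trans (K2P K K2K).
  by rewrite opprB.
Qed.

End ExpandingSystems.

(** * The tree of shadowing orbits *)

Definition cauchy_complete {R : realType} (X : metricType R) :=
  forall u : nat -> X,
    (forall e, 0 < e -> exists P, forall p q, (P <= p)%N -> (P <= q)%N ->
      mdist (u p) (u q) < e) ->
    exists x, forall e, 0 < e -> exists P, forall p, (P <= p)%N ->
      mdist (u p) x < e.

Lemma infinite_setP (A : set nat) :
  (forall K, exists2 n, A n & (K <= n)%N) -> infinite_set A.
Proof.
move=> Aub /finite_seqP[s As].
have [n An] := Aub (\max_(i <- s) i).+1.
by rewrite ltnNge => /negP; apply; apply: leq_bigmax_seq => //; move: An; rewrite As.
Qed.

Lemma size_le_sum_count (T : Type) (s : seq T) (P : nat -> pred T) Nb :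
  all (fun x => [exists i : 'I_Nb, P i x]) s ->
  (size s <= \sum_(i < Nb) count (P i) s)%N.
Proof.
elim: s => // x s IHs /= /andP[/existsP[i0 Px] /IHs sz].
rewrite big_split/= -addn1 addnC leq_add// (bigD1 i0)//= Px.
exact: leq_addr.
Qed.

Section Tree.
Context {R : realType} {X : metricType R}.
Context (f : X -> X) (D : nat) (a C r0 delta : R) (x0 : X).
Context (k l : nat -> nat) (zz : nat -> X).
Context (D_gt0 : (0 < D)%N) (f_degree : has_degree f D).
Context (f_inj : injective_at_scale f delta).
Context (a_gt0 : 0 < a) (C_gt0 : 0 < C) (r0_gt0 : 0 < r0).
Context (f_back : backward_contracting f a C).
Context (X_bounded : forall x y : X, mdist x y < r0).

(** At level [i] the orbit of a node sits on [zz i] at time [k i], and its descendants shadow it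
    until [N i]; the root is a target at time 0. [CC] is the sum of the series with terms
    [C * r0 * expR (- a * m)], which bounds errors accumulated over levels, and [eta] is small
    enough for four such errors to stay below [delta]. *)
Let N i := (k i + l i)%N.
Let CC := C * r0 / (1 - expR (- a)).
Let eta := delta / 8.

Context (k0 : k 0%N = 0%N) (x0zz : x0 = zz 0%N).
Context (Nk : forall i, (N i < k i.+1)%N).
Context (l_eta : forall i, CC * expR (- a * (l i)%:R) <= eta).

(** The possible positions at time [N i] from which the orbit reaches [zz i.+1] exactly at time
    [k i.+1]; they index the children of a node. *)
Let fib i : {s : seq X | [/\ uniq s, size s = (D ^ (k i.+1 - N i))%N &
  forall x, (x \in s) = (iter (k i.+1 - N i) f x == zz i.+1)]}.
Proof. exact/cid/has_degree_iter. Qed.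

Let W i : seq X := projT1 (fib i).

Let branch_ex i x w : {y | iter (N i) f y = w /\ forall j, (j <= N i)%N ->
  mdist (iter j f x) (iter j f y) <= C * expR (- a * (N i - j)%:R) * r0}.
Proof.
apply: cid; have [y yw xy] := f_back (X_bounded (iter (N i) f x) w).
by exists y.
Qed.

(** The child of [x] that shadows [x] up to time [N i] and is then at [w]. *)
Definition branch i x w := projT1 (branch_ex i x w).

Lemma iter_branch i x w : iter (N i) f (branch i x w) = w.
Proof. by have [] := projT2 (branch_ex i x w). Qed.

Definition children i x := [seq branch i x w | w <- W i].

Fixpoint nodes i :=
  if i is i'.+1 then flatten [seq children i' x | x <- nodes i'] else [:: x0].

Fixpoint desc i x q :=
  if q is q'.+1 then flatten [seq desc i.+1 y q' | y <- children i x]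
  else [:: x].

(** The exponent of [D] in the number of descendants of a level [i] node after [q] generations, as
    [size_desc] shows. *)
Definition height i q := (\sum_(t < q) (k (i + t).+1 - N (i + t)))%N.

Lemma heightS i q : height i q.+1 = ((k i.+1 - N i) + height i.+1 q)%N.
Proof.
rewrite /height big_ord_recl addn0; congr (_ + _)%N.
by apply: eq_bigr => t _; rewrite lift0 addSnnS.
Qed.

Lemma heightD i q t : height i (q + t) = (height i q + height (i + q) t)%N.
Proof.
elim: q i => [|q IHq] i; first by rewrite /height big_ord0 add0n addn0.
by rewrite addSn !heightS IHq addnA addSnnS.
Qed.

Lemma size_children i x : size (children i x) = (D ^ (k i.+1 - N i))%N.
Proof. by rewrite size_map; have [_ ->] := projT2 (fib i). Qed.

Lemma size_desc i x q : size (desc i x q) = (D ^ height i q)%N.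
Proof.
elim: q i x => [|q IHq] i x; first by rewrite /height big_ord0.
rewrite heightS expnD -(size_children i x) /= size_flatten /shape -map_comp.
rewrite (eq_map (g := fun=> (D ^ height i.+1 q)%N)) => [|y]; last exact: IHq.
by rewrite sumnE big_map big_const_seq count_predT iter_addn_0 mulnC.
Qed.

Lemma nodes_desc i q : nodes (i + q) = flatten [seq desc i x q | x <- nodes i].
Proof.
elim: q i => [|q IHq] i; first by rewrite addn0 /=; elim: (nodes i) => //= x s <-.
rewrite -addSnnS IHq /=; elim: (nodes i) => //= x s IHs.
by rewrite map_cat flatten_cat IHs.
Qed.

Lemma nodes_desc0 q : nodes q = desc 0 x0 q.
Proof. by rewrite -[q in LHS]add0n nodes_desc /= cats0. Qed.

Lemma size_nodes q : size (nodes q) = (D ^ height 0 q)%N.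
Proof. by rewrite nodes_desc0 size_desc. Qed.

Lemma iter_nodes i x : x \in nodes i -> iter (k i) f x = zz i.
Proof.
case: i => [|i]; first by rewrite inE => /eqP ->; rewrite k0.
move=> /flattenP[_ /mapP[x' _ ->] /mapP[w Ww ->]].
rewrite -(subnK (ltnW (Nk i))) iterD iter_branch.
by apply/eqP; have [_ _ <-] := projT2 (fib i).
Qed.

Lemma ge_N i : (i <= N i)%N.
Proof.
elim: i => // i IHi; apply: leq_trans (leq_addr _ _).
exact: leq_ltn_trans (Nk i).
Qed.

Let ea1 : expR (- a) < 1.
Proof. by rewrite expR_lt1 oppr_lt0. Qed.

Let CC_gt0 : 0 < CC.
Proof. by rewrite divr_gt0 ?mulr_gt0// subr_gt0. Qed.

Let CCE : CC = C * r0 + CC * expR (- a).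
Proof.
rewrite -[LHS](subrK (CC * expR (- a))); congr (_ + _).
by rewrite -[X in X - _]mulr1 -mulrBr /CC divfK// gt_eqF// subr_gt0.
Qed.

Lemma dist_branch i x w j : (j <= N i)%N ->
  mdist (iter j f x) (iter j f (branch i x w)) <=
    C * r0 * expR (- a * (N i - j)%:R).
Proof.
by rewrite mulrAC; have [_] := projT2 (branch_ex i x w); apply.
Qed.

(** Each generation adds one shadowing error, and these decrease geometrically because [N] increases
    by at least 1 per level; [CCE] is the resulting fixed-point equation for their sum. *)
Lemma dist_desc i x q x' j : x' \in desc i x q -> (j <= N i)%N ->
  mdist (iter j f x) (iter j f x') <= CC * expR (- a * (N i - j)%:R).
Proof.
elim: q i x => [|q IHq] i x.
  by rewrite inE => /eqP -> _; rewrite mdistxx mulr_ge0 ?expR_ge0// ltW.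
move=> /flattenP[_ /mapP[_ /mapP[w _ ->] ->] x'y] jN.
have NS : (N i < N i.+1)%N by rewrite (leq_trans (Nk i))// leq_addr.
apply: le_trans (metric_triangle _ (iter j f (branch i x w)) _) _.
rewrite [in leRHS]CCE mulrDl lerD ?dist_branch//.
apply: le_trans (IHq _ _ x'y (leq_trans jN (ltnW NS))) _.
rewrite -mulrA ler_pM2l// -expRD ler_expR.
have : (N i - j)%:R + 1 <= (N i.+1 - j)%:R :> R.
  by rewrite natr1 ler_nat ltn_sub2r// (leq_ltn_trans jN).
by move=> /(ler_wpM2l (ltW a_gt0)); lra.
Qed.

Lemma small_contraction i j : (j <= k i)%N ->
  CC * expR (- a * (N i - j)%:R) <= eta.
Proof.
move=> jk; apply: le_trans (l_eta i); rewrite ler_pM2l// ler_expR !mulNr lerN2.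
by rewrite ler_pM2l// ler_nat /N addnC -addnBA// leq_addr.
Qed.

Lemma dist_desc_eta i x q x' j : x' \in desc i x q -> (j <= k i)%N ->
  mdist (iter j f x) (iter j f x') <= eta.
Proof.
move=> xx' jk; apply: le_trans (small_contraction jk).
by apply: dist_desc xx' _; rewrite (leq_trans jk)// leq_addr.
Qed.

Let eta_gt0 : 0 < eta.
Proof. by apply: lt_le_trans (l_eta 0%N); rewrite mulr_gt0 ?expR_gt0. Qed.

(** Local injectivity is applied successively from time [n - 1] down to 0. *)
Lemma iter_inj_at_scale n (x y : X) :
  (forall j, (j < n)%N -> mdist (iter j f x) (iter j f y) < delta) ->
  iter n f x = iter n f y -> x = y.
Proof.
elim: n => // n IHn h /f_inj fxy.
by apply: IHn => [j jn|]; [apply: h; exact: ltnW|apply: fxy; exact: h].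
Qed.

(** A child determines [w] as its image at time [N i]. Two parents with a common child both stay
    [eta]-close to it up to time [k i], where both are at [zz i], so they coincide by injectivity at
    scale [delta]. *)
Lemma uniq_nodes i : uniq (nodes i).
Proof.
elim: i => //= i IHi.
apply: (@allpairs_uniq_dep _ _ _ (branch i) (nodes i) (fun=> W i)) => //.
  by move=> x _; have [] := projT2 (fib i).
move=> _ _ /allpairsPdep[x [w [xi _ ->]]] /allpairsPdep[x' [w' [x'i _ ->]]] /= e.
have ww' : w = w' by rewrite -(iter_branch i x w) e iter_branch.
rewrite -{w'}ww' in e *; suff -> : x = x' by [].
apply: (@iter_inj_at_scale (k i)); last by rewrite !iter_nodes.
move=> j jk.
have jN : (j <= N i)%N by rewrite (leq_trans (ltnW jk))// leq_addr.
have h y : y \in nodes i -> mdist (iter j f y) (iter j f (branch i y w)) <= eta.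
  move=> yi; apply: le_trans (dist_branch _ _ jN) _.
  apply: le_trans (small_contraction (ltnW jk)).
  by rewrite ler_pM2r ?expR_gt0// CCE lerDl mulr_ge0 ?expR_ge0// ltW.
apply: le_lt_trans (metric_triangle _ (iter j f (branch i x w)) _) _.
have h1 := h x xi; have h2 := h x' x'i.
rewrite -e (metric_sym (iter j f x')) in h2.
by move: eta_gt0 h1 h2; rewrite /eta; lra.
Qed.

(** The iterate of order [n] is injective on [s] and sends it into the fibre of [zz i] under the
    iterate of order [k i - n]. *)
Lemma size_separated i n (s : seq X) : (n <= k i)%N -> uniq s ->
  {subset s <= nodes i} ->
  (forall x y j, x \in s -> y \in s -> (j < n)%N ->
    mdist (iter j f x) (iter j f y) < delta) ->
  (size s <= D ^ (k i - n))%N.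
Proof.
move=> nk us si sep.
have [t [ut <- mt]] := has_degree_iter (k i - n) f_degree (zz i).
rewrite -(size_map (iter n f)); apply: uniq_leq_size.
  rewrite map_inj_in_uniq// => x y xs ys.
  by apply: iter_inj_at_scale => j; exact: sep.
move=> _ /mapP[x xs ->]; rewrite mt -iterD subnK// iter_nodes//.
exact: si.
Qed.

(** Ancestors at level [i] of nodes in the ball stay [delta]-close to each other before time [n], so
    [size_separated] bounds their number; each has [D ^ height i q] descendants. *)
Lemma count_nodes_le i q n p : (n <= k i)%N ->
  (count (fun x => `[< bowen_ball f n p eta x >]) (nodes (i + q))
     <= D ^ height i q * D ^ (k i - n))%N.
Proof.
move=> nk; set B := (fun x => _).
pose s := [seq x <- nodes i | has B (desc i x q)].
have ss : (size s <= D ^ (k i - n))%N.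
  apply: size_separated => //; first by rewrite filter_uniq// uniq_nodes.
    by move=> x; rewrite mem_filter => /andP[].
  move=> x y j; rewrite !mem_filter => /andP[/hasP[x' xx' /asboolP Bx'] _].
  move=> /andP[/hasP[y' yy' /asboolP By'] _] jn.
  have jk : (j <= k i)%N by rewrite (leq_trans (ltnW jn)).
  have h1 := dist_desc_eta xx' jk; have h2 := dist_desc_eta yy' jk.
  have h3 := Bx' j jn; have h4 := By' j jn.
  have h5 := metric_triangle (iter j f x) (iter j f x') (iter j f y).
  have h6 := metric_triangle (iter j f x') (iter j f p) (iter j f y).
  have h7 := metric_triangle (iter j f p) (iter j f y') (iter j f y).
  rewrite (metric_sym (iter j f x') (iter j f p)) in h6.
  rewrite (metric_sym (iter j f y') (iter j f y)) in h7.
  by move: eta_gt0 h1 h2 h3 h4; rewrite /eta; lra.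
apply: leq_trans (leq_mul (leqnn _) ss).
rewrite nodes_desc /s; elim: (nodes i) => [|x t IHt] /=; first by rewrite muln0.
rewrite count_cat; case: ifPn => [Bx|nBx] /=.
  by rewrite mulnS leq_add// -(size_desc i x q) count_size.
by rewrite (_ : count B _ = 0%N) ?add0n//; apply/eqP; rewrite -leqn0 leqNgt -has_count.
Qed.

Lemma exists_stage L n : (0 < L)%N -> (n <= k L)%N ->
  exists i, [/\ (i < L)%N, (k i <= n)%N & (n <= k i.+1)%N].
Proof.
elim: L => // -[|L] IHL _ nk; first by exists 0%N; rewrite k0.
have [nkL|kLn] := leqP n (k L.+1).
  by have [//|i [iL kin nki]] := IHL isT; exists i; split=> //; exact: ltnW.
by exists L.+1; split=> //; exact: ltnW.
Qed.

(* The uniform mass distribution on the nodes gives a Bowen ball of order [n]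
   mass at most [e^c0 e^(-s n)]; the worst case is [n = N i]. *)
Lemma count_bowen_ball_le (s c0 : R) L n p : 0 <= s -> s <= ln D%:R ->
  (forall i, s * (N i)%:R <= ln D%:R * (height 0 i)%:R + c0) ->
  (0 < L)%N -> (n <= k L)%N ->
  (count (fun x => `[< bowen_ball f n p eta x >]) (nodes L))%:R <=
    (size (nodes L))%:R * (expR c0 * expR (- s * n%:R)).
Proof.
move=> s0 sh growth L0 nkL; have [i [iL kin nki]] := exists_stage L0 nkL.
have DE m : (D ^ m)%:R = expR (ln D%:R * m%:R) :> R.
  by rewrite natrX mulrC expRM_natl lnK// posrE ltr0n.
have LE : L = (i + (L - i.+1).+1)%N by rewrite -addSnnS subnKC.
rewrite size_nodes {2}LE heightD heightS add0n DE -!expRD.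
set H1 := height 0 i; set H3 := height i.+1 _.
have g := growth i; rewrite -/H1 in g.
have [nN|Nn] := leqP n (N i).
  (* For [n] between [k i] and [N i] the order is lowered to [k i]: the ball then meets the
     descendants of at most one node of level [i]. *)
  apply: le_trans (_ : (D ^ height i (L - i.+1).+1 * D ^ (k i - k i))%:R <= _).
    rewrite ler_nat {1}LE; apply: leq_trans (count_nodes_le _ p (leqnn _)).
    apply: sub_count => x /asboolP Bx; apply/asboolP => j jk; apply: Bx.
    exact: leq_trans kin.
  rewrite subnn expn0 muln1 heightS DE ler_expR -/H3 [in leRHS]natrD.
  have : s * n%:R <= s * (N i)%:R by rewrite ler_wpM2l// ler_nat.
  by move: g; lra.
(* For [n] between [N i] and [k i.+1] the ancestors are counted at level [i.+1]. *)
apply: le_trans (_ : (D ^ H3 * D ^ (k i.+1 - n))%:R <= _).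
  by rewrite ler_nat {1}LE -addSnnS; exact: count_nodes_le.
rewrite natrM !DE -expRD ler_expR !natrD !natrB// ?(ltnW (Nk i))//.
have : (ln D%:R - s) * (N i)%:R <= (ln D%:R - s) * n%:R.
  by rewrite ler_wpM2l ?subr_ge0// ler_nat ltnW.
by move: g; lra.
Qed.

Definition is_path (xp : nat -> X) :=
  xp 0%N = x0 /\ forall i, xp i.+1 \in children i (xp i).

Lemma path_desc xp i q : is_path xp -> xp (i + q)%N \in desc i (xp i) q.
Proof.
move=> [xp0 xpS]; elim: q i => [|q IHq] i; first by rewrite addn0 inE.
rewrite -addSnnS /=; apply/flattenP; exists (desc i.+1 (xp i.+1) q) => //.
exact: map_f.
Qed.

Lemma path_nodes xp i : is_path xp -> xp i \in nodes i.
Proof. by move=> xpP; have := path_desc 0 i xpP; rewrite xpP.1 -nodes_desc0. Qed.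

Lemma contraction_vanishes j e : 0 < e ->
  exists P, forall i, (P <= i)%N -> CC * expR (- a * (N i - j)%:R) <= e.
Proof.
move=> e0; have [P PP] := expR_decay a_gt0 CC_gt0 e0.
exists (P + j)%N => i Pi; apply: PP.
have PN : (P + j <= N i)%N := leq_trans Pi (ge_N i).
by rewrite -(leq_add2r j) subnK// (leq_trans (leq_addl P j) PN).
Qed.

(** By [dist_desc] at time 0 the path is a Cauchy sequence. The estimates at a fixed time [j] pass
    to the limit because the iterate of order [j] is Lipschitz. *)
Lemma path_limit (b C' : R) xp : 0 < C' -> forward_expanding f b C' ->
  cauchy_complete X ->
  is_path xp ->
  exists x, forall i j, (j <= N i)%N ->
    mdist (iter j f (xp i)) (iter j f x) <= CC * expR (- a * (N i - j)%:R).
Proof.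
move=> C'0 fb complete xpP.
have xpd i q j : (i <= q)%N -> (j <= N i)%N ->
    mdist (iter j f (xp i)) (iter j f (xp q)) <= CC * expR (- a * (N i - j)%:R).
  move=> iq jN; apply: dist_desc jN; rewrite -{1}(subnKC iq).
  exact: path_desc.
have [e e0|x xP] := complete xp.
  have e3 : 0 < e / 3 by rewrite divr_gt0.
  have [P PP] := contraction_vanishes 0 e3.
  exists P => p q Pp Pq; apply: le_lt_trans (metric_triangle _ (xp P) _) _.
  rewrite (metric_sym (xp p)).
  have := le_trans (xpd P p 0%N Pp isT) (PP P (leqnn _)).
  have := le_trans (xpd P q 0%N Pq isT) (PP P (leqnn _)).
  by move: e0; rewrite /=; lra.
exists x => i j jN; apply/ler_addgt0Pr => e e0.
have d0 : 0 < e / (C' * expR (b * j%:R)) by rewrite divr_gt0// mulr_gt0 ?expR_gt0.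
have [P PP] := xP _ d0.
have := PP (maxn P i) (leq_maxl _ _); set q := maxn P i => qx.
apply: le_trans (metric_triangle _ (iter j f (xp q)) _) _.
rewrite lerD ?xpd ?leq_maxr//; apply: le_trans (fb _ _ _) _.
by rewrite mulrC -ler_pdivlMr ?mulr_gt0 ?expR_gt0// ltW.
Qed.

Definition path_limits : set X := [set x | exists2 xp, is_path xp &
  forall i j, (j <= N i)%N ->
    mdist (iter j f (xp i)) (iter j f x) <= CC * expR (- a * (N i - j)%:R)].

(* Koenig's lemma in place of compactness: if no finite level is captured by
   finitely many balls, some path consists of uncaptured nodes only, and the ball
   containing its limit also contains all late descendants along the path. *)
Lemma finite_capture (I : set nat) (n : nat -> nat) (p : nat -> X) (eps : R) :
  (forall xp, is_path xp -> exists x, forall i j, (j <= N i)%N ->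
    mdist (iter j f (xp i)) (iter j f x) <= CC * expR (- a * (N i - j)%:R)) ->
  path_limits `<=` \bigcup_(i in I) bowen_ball f (n i) (p i) eps ->
  exists Nb L0, forall L, (L0 <= L)%N -> forall x, x \in nodes L ->
    exists i, [/\ (i < Nb)%N, I i & bowen_ball f (n i) (p i) eps x].
Proof.
move=> lims cover; apply: contrapT => ncap.
pose captured Nb x := exists i, [/\ (i < Nb)%N, I i & bowen_ball f (n i) (p i) eps x].
have captured_le Nb Nb' x : (Nb <= Nb')%N -> captured Nb x -> captured Nb' x.
  by move=> NN [i [iN Ii Bx]]; exists i; split=> //; exact: leq_trans NN.
(* One finite subfamily captures all late descendants of [x]. A node has finitely many children, so
   a node that is not good has a child that is not good. *)
pose good i x := exists Nb L0, forall q, (L0 <= q)%N -> forall x',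
  x' \in desc i x q -> captured Nb x'.
have good_children i x : (forall y, y \in children i x -> good i.+1 y) -> good i x.
  move=> /= gc.
  have [m mP] : exists m, forall y, y \in children i x -> forall q, (m <= q)%N ->
      forall x', x' \in desc i.+1 y q -> captured m x'.
    elim: (children i x) gc => [|y s IHs] gc; first by exists 0%N.
    have [|m mP] := IHs; first by move=> z zs; apply: gc; rewrite inE zs orbT.
    have [Nb [L0 NbP]] := gc y (mem_head _ _).
    exists (maxn m (maxn Nb L0)) => z; rewrite inE => /predU1P[->|zs] q;
      rewrite !geq_max => /andP[mq /andP[_ Lq]] x' zx'.
      by apply: captured_le (NbP q Lq x' zx'); rewrite !leq_max leqnn !orbT.
    by apply: captured_le (mP z zs q mq x' zx'); rewrite leq_maxl.
  exists m, m.+1 => -[//|q] mq x' /flattenP[_ /mapP[y yx ->] x'y].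
  exact: mP yx _ mq _ x'y.
have bad0 : ~ good 0%N x0.
  by move=> [Nb [L0 g0]]; apply: ncap; exists Nb, L0 => L LL x; rewrite nodes_desc0; exact: g0.
have step (ix : nat * X) : {y | ~ good ix.1 ix.2 ->
    y \in children ix.1 ix.2 /\ ~ good ix.1.+1 y}.
  apply: cid; have [g|ng] := pselect (good ix.1 ix.2); first by exists ix.2.
  have [y yP] : exists y, ~ (y \in children ix.1 ix.2 -> good ix.1.+1 y).
    by apply/existsNP => gc; apply: ng; exact: good_children.
  by exists y => _; split; [apply: contrapT => ny; apply: yP => /ny|move=> gy; apply: yP].
pose xp := fix xp i := if i is i'.+1 then projT1 (step (i', xp i')) else x0.
have bad i : ~ good i (xp i).
  by elim: i => [//|i IHi]; have [] := projT2 (step (i, xp i)) IHi.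
have xpP : is_path xp.
  by split=> // i; have [] := projT2 (step (i, xp i)) (bad i).
have [x xP] := lims xp xpP.
have [i Ii Bx] := cover x (ex_intro2 _ _ xp xpP xP).
have late j : exists m, (j < n i)%N -> forall q, (m <= q)%N ->
    CC * expR (- a * (N q - j)%:R) * 2 < eps - mdist (iter j f (p i)) (iter j f x).
  have [jn|nj] := ltnP j (n i); last by exists 0%N.
  have e0 : 0 < (eps - mdist (iter j f (p i)) (iter j f x)) / 3.
    by rewrite divr_gt0// subr_gt0; exact: Bx.
  have [m mP] := contraction_vanishes j e0; exists m => _ q mq.
  by have := mP q mq; move: e0; lra.
have [m mP] := choice late.
(* This level is late enough that every time [j < n i] is at most [N M], and that two errors fit in
   the room left inside the open ball at each of these times. *)
pose M := maxn (n i) (\max_(j < n i) m j).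
apply: (bad M); exists i.+1, 0%N => q _ x' x'M; exists i; split=> // j jn.
have jN : (j <= N M)%N.
  by rewrite (leq_trans (ltnW jn))// (leq_trans _ (ge_N _))// leq_maxl.
have mM : (m j <= M)%N.
  by rewrite leq_max (leq_bigmax (Ordinal jn)) orbT.
have h1 := mP j jn M mM; have h2 := dist_desc x'M jN; have h3 := xP M j jN.
have h4 := metric_triangle (iter j f (p i)) (iter j f x) (iter j f x').
have h5 := metric_triangle (iter j f x) (iter j f (xp M)) (iter j f x').
rewrite (metric_sym (iter j f x) (iter j f (xp M))) in h5.
by move: h1 h2 h3 h4 h5; lra.
Qed.

Lemma ge_k i : (i <= k i)%N.
Proof. by case: i => // i; exact: leq_ltn_trans (ge_N i) (Nk i). Qed.

(** A mass distribution argument: in a cover of total weight below [expR (- c0)], finitely many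
    balls already contain all nodes of a late level, yet by [count_bowen_ball_le] they contain fewer
    nodes than that level has. *)
Lemma bowen_measure_path_limits (s c0 : R) Z :
  (forall xp, is_path xp -> exists x, forall i j, (j <= N i)%N ->
    mdist (iter j f (xp i)) (iter j f x) <= CC * expR (- a * (N i - j)%:R)) ->
  path_limits `<=` Z -> 0 <= s -> s <= ln D%:R ->
  (forall i, s * (N i)%:R <= ln D%:R * (height 0 i)%:R + c0) ->
  bowen_measure f s eta Z <> 0%E.
Proof.
move=> lims KZ s0 sh growth /bowen_measure_eq0P m0.
have [c [I [n [p [_ Zcov ->]]]] lc] : exists2 c, [set c | exists (I : set nat)
    (n : nat -> nat) (x : nat -> X), [/\ forall i, I i -> (0 <= n i)%N,
    Z `<=` \bigcup_(i in I) bowen_ball f (n i) (x i) eta &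
    c = \esum_(i in I) (expR (- s * (n i)%:R))%:E]] c & (c < (expR (- c0))%:E)%E.
  have : (bowen_premeasure f s 0 eta Z < (expR (- c0))%:E)%E.
    apply: le_lt_trans (m0 0%N (expR (- c0) / 2) _) _; first by rewrite divr_gt0 ?expR_gt0.
    by rewrite lte_fin ltr_pdivrMr// ltr_pMr ?expR_gt0// ltr1n.
  by move=> /ereal_inf_lt[c cP lc]; exists c.
have [Nb [L0 NbP]] := finite_capture lims (subset_trans KZ Zcov).
(* Since [L <= k L], all the orders involved are at most [k L]. *)
pose L := maxn L0 (\max_(i < Nb) n i).+1.
have L_gt0 : (0 < L)%N by rewrite leq_max orbT.
have nL i : (i < Nb)%N -> (n i <= k L)%N.
  move=> iNb; apply: leq_trans (ge_k L); rewrite leq_max; apply/orP; right.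
  exact: leqW (leq_bigmax (Ordinal iNb)).
pose B i x := `[< bowen_ball f (n i) (p i) eta x >].
have := @size_le_sum_count X (nodes L) (fun i x => (i \in I) && B i x) Nb.
have -> : all (fun x => [exists i : 'I_Nb, (val i \in I) && B i x]) (nodes L).
  apply/allP => x /(NbP L (leq_maxl _ _))[i [iNb Ii Bx]].
  by apply/existsP; exists (Ordinal iNb) => /=; rewrite mem_set//; exact/asboolP.
move=> /(_ isT); rewrite -(ler_nat R) natr_sum leNgt => /negP; apply.
have sL : 0 < (size (nodes L))%:R :> R by rewrite ltr0n size_nodes expn_gt0 D_gt0.
apply: le_lt_trans (_ : (size (nodes L))%:R * expR c0 *
   (\sum_(0 <= i < Nb | i \in I) expR (- s * (n i)%:R)) < _).
  rewrite big_mkord mulr_sumr [leRHS]big_mkcond; apply: ler_sum => i _.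
  case: ifPn => [iI|/negbTE iI]; last by rewrite /= (eq_count (a2 := pred0)) ?count_pred0// => x; rewrite iI.
  rewrite -mulrA; apply: le_trans (count_bowen_ball_le (p i) s0 sh growth L_gt0 (nL i (ltn_ord i))).
  by rewrite ler_nat; apply: sub_count => x /andP[].
rewrite -mulrA gtr_pMr// -ltr_pdivlMl ?expR_gt0// mulr1 -expRN -lte_fin.
apply: le_lt_trans lc; rewrite -sumEFin.
rewrite [in leRHS](_ : I = [set x | x \in I]); last first.
  by apply/seteqP; split=> x; rewrite /= inE.
rewrite -nneseries_esum; last by move=> i _; rewrite lee_fin expR_ge0.
apply: nneseries_lim_ge => i _; by rewrite lee_fin expR_ge0.
Qed.

Lemma path_limits_target i x : path_limits x ->
  mdist (iter (k i) f x) (zz i) <= CC * expR (- a * (l i)%:R).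
Proof.
move=> [xp xpP xP]; have := xP i (k i) (leq_addr _ _).
by rewrite (iter_nodes (path_nodes i xpP)) metric_sym /N addKn.
Qed.

Lemma path_limits_neq0 :
  (forall xp, is_path xp -> exists x, forall i j, (j <= N i)%N ->
    mdist (iter j f (xp i)) (iter j f x) <= CC * expR (- a * (N i - j)%:R)) ->
  path_limits !=set0.
Proof.
move=> lims; pose xp := fix xp i :=
  if i is i'.+1 then nth x0 (children i' (xp i')) 0 else x0.
have xpP : is_path xp.
  by split=> // i; apply: mem_nth; rewrite size_children expn_gt0 D_gt0.
by have [x xP] := lims xp xpP; exists x; exists xp.
Qed.

End Tree.

(** Stage [i.+1] serves the target sequence of index [(logn 2 i.+1).+1] at a time admissible for it
    in the sense of [G]. The factor [Q.+1] makes the stages as sparse as desired. *)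
Lemma exists_stages (l : nat -> nat -> nat) (l0 Q : nat) (G : nat -> nat -> Prop) :
  (forall j K, (1 <= j)%N -> exists2 k, (K <= k)%N & G j k) ->
  exists k m : nat -> nat, [/\ k 0%N = 0%N, m 0%N = l0,
    forall i, (Q.+1 * (k i + m i) < k i.+1)%N,
    forall i, G (logn 2 i.+1).+1 (k i.+1) &
    forall i, m i.+1 = l (logn 2 i.+1).+1 (k i.+1)].
Proof.
move=> GP.
have step (p : nat * nat) : {k | (p.2 <= k)%N /\ G p.1.+1 k}.
  by apply: cid; have [k pk Gk] := GP p.1.+1 p.2 isT; exists k.
pose nxt i (km : nat * nat) : nat * nat :=
  let k' := projT1 (step (logn 2 i.+1, (Q.+1 * (km.1 + km.2)).+1)) in
  (k', l (logn 2 i.+1).+1 k').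
pose st := fix st i := if i is i'.+1 then nxt i' (st i') else (0%N, l0).
exists (fun i => (st i).1), (fun i => (st i).2); split=> // i /=.
- by have [] := projT2 (step (logn 2 i.+1, (Q.+1 * ((st i).1 + (st i).2)).+1)).
- by have [] := projT2 (step (logn 2 i.+1, (Q.+1 * ((st i).1 + (st i).2)).+1)).
Qed.

(** * Intersections of shrinking targets *)

Section ShrinkingTargets.
Context {R : realType} {X : metricType R}.
Context (f : X -> X) (D : nat) (a C b C' r0 delta : R) (x0 : X).
Context (D_gt0 : (0 < D)%N) (f_degree : has_degree f D).
Context (delta_gt0 : 0 < delta) (f_inj : injective_at_scale f delta).
Context (a_gt0 : 0 < a) (C_gt0 : 0 < C) (r0_gt0 : 0 < r0).
Context (f_back : backward_contracting f a C).
Context (X_bounded : forall x y : X, mdist x y < r0).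
Context (C'_gt0 : 0 < C') (f_forw : forward_expanding f b C').
Context (X_complete : cauchy_complete X).
Context (phi : nat -> nat -> R) (z : nat -> nat -> X).

Let S := \bigcap_(j in [set j | (1 <= j)%N]) shrinking_target f (phi j) (z j).
Let CC := C * r0 / (1 - expR (- a)).
Let eta := delta / 8.

Let CC_gt0 : 0 < CC.
Proof. by rewrite divr_gt0 ?mulr_gt0// subr_gt0 expR_lt1 oppr_lt0. Qed.

Let eta_gt0 : 0 < eta.
Proof. by rewrite divr_gt0. Qed.

(* [logn 2 i.+1] takes every value infinitely often. *)
Let path_limits_in_targets (k m : nat -> nat) (T : set X) :
  (forall i, (k i < k i.+1)%N) ->
  (forall i x, T x -> mdist (iter (k i.+1) f x)
     (z (logn 2 i.+1).+1 (k i.+1)) <= CC * expR (- a * (m i.+1)%:R)) ->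
  (forall i, CC * expR (- a * (m i.+1)%:R) < phi (logn 2 i.+1).+1 (k i.+1)) ->
  T `<=` S.
Proof.
move=> kS Tz mphi x Tx [|j] //= _; apply: infinite_setP => K.
(* The odd factor gives [i.+1] the 2-adic valuation [j] and makes it larger than [K]. *)
pose i := (2 ^ j * (2 * K).+1).-1.
have iE : i.+1 = (2 ^ j * (2 * K).+1)%N by rewrite prednK// muln_gt0 expn_gt0.
have lE : logn 2 i.+1 = j.
  rewrite iE lognM ?expn_gt0// pfactorK// logn_coprime ?addn0//.
  by rewrite coprime2n/= mul2n odd_double.
have gek n : (n <= k n)%N by elim: n => // n IHn; exact: leq_ltn_trans IHn (kS n).
exists (k i.+1); first by rewrite /= -lE; apply: le_lt_trans (Tz i x Tx) (mphi i).
apply: leq_trans (gek _); rewrite iE; apply: (@leq_trans (2 * K).+1).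
  by rewrite mul2n -addnn -addnS leq_addr.
by rewrite -[leqLHS]mul1n leq_mul2r expn_gt0.
Qed.

(** Without any control on the decay of [phi], the shadowing length is chosen after the time [k] so
    that the error is at most half the radius at that time; one path limit is enough. *)
Lemma shrinking_targets_neq0 :
  (forall j k, (1 <= j)%N -> 0 < phi j k) -> S !=set0.
Proof.
move=> phi_gt0.
have lP (jk : nat * nat) : {l : nat | (1 <= jk.1)%N ->
    CC * expR (- a * l%:R) <= Num.min eta (phi jk.1 jk.2 / 2)}.
  apply: cid; have [j1|] := boolP (1 <= jk.1)%N; last by exists 0%N.
  have m0 : 0 < Num.min eta (phi jk.1 jk.2 / 2).
    by rewrite lt_min eta_gt0 divr_gt0// phi_gt0.
  by have [l lP] := expR_decay a_gt0 CC_gt0 m0; exists l => _; exact: lP.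
have [l0 l0P] := expR_decay a_gt0 CC_gt0 eta_gt0.
have [|k [m [k0 m0 km _ mE]]] := @exists_stages (fun j k => projT1 (lP (j, k))) l0 0 (fun _ _ => True).
  by move=> j K _; exists K.
have lE i : CC * expR (- a * (m i.+1)%:R) <=
    Num.min eta (phi (logn 2 i.+1).+1 (k i.+1) / 2).
  by rewrite mE; exact: (projT2 (lP ((logn 2 i.+1).+1, k i.+1))).
pose zz i := if i is i'.+1 then z (logn 2 i'.+1).+1 (k i'.+1) else x0.
have Nk i : (k i + m i < k i.+1)%N by rewrite -[X in (X < _)%N]mul1n.
have l_eta i : CC * expR (- a * (m i)%:R) <= eta.
  case: i => [|i]; first by rewrite m0 l0P.
  by apply: le_trans (lE i) _; rewrite ge_min lexx.
have lims xp := @path_limit R X f D a C r0 x0 k m zz f_degree a_gt0 C_gt0 r0_gt0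
  f_back X_bounded Nk b C' xp C'_gt0 f_forw X_complete.
have [x xP] := path_limits_neq0 D_gt0 lims; exists x.
apply: (path_limits_in_targets (k := k) (m := m)) xP => [i|i y yP|i].
- by apply: leq_ltn_trans (Nk i); exact: leq_addr.
- exact: (path_limits_target (zz := zz) k0 erefl Nk i.+1 yP).
- apply: le_lt_trans (lE i) _; rewrite gt_min; apply/orP; right.
  by rewrite ltr_pdivrMr// ltr_pMr ?phi_gt0// ltr1n.
Qed.

Lemma htop_shrinking_targets_ge (sigma s : R) : 0 <= sigma ->
  (forall j K, (1 <= j)%N ->
    exists2 k, (K <= k)%N & expR (- sigma * k%:R) <= phi j k) ->
  s * (1 + sigma / a) <= ln D%:R -> (s%:E <= htop f S)%E.
Proof.
move=> sg0 phiP sD; apply: (htop_ge eta_gt0) => t t0 ts.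
have sa0 : 0 <= sigma / a by rewrite divr_ge0// ltW.
(* The slack gained from [t < s] pays for the nodes lost before the last stage. *)
pose gap := ln D%:R - t * (1 + sigma / a).
have gap0 : 0 < gap.
  rewrite subr_gt0; apply: lt_le_trans sD; rewrite ltr_pM2r//.
  by rewrite ltr_pwDl.
have CCe : CC / eta \is Num.pos by rewrite posrE; exact: divr_gt0.
(* With this [c], the length [l k] brings the error below both [eta] and [expR (- sigma * k)]. *)
pose c := `|ln (CC / eta)| + `|ln CC|.
have c0 : 0 <= c by rewrite addr_ge0.
pose l (k : nat) := (Num.truncn ((sigma * k%:R + c) / a)).+1.
have lgt k : sigma * k%:R + c < a * (l k)%:R.
  by rewrite [ltRHS]mulrC -ltr_pdivrMr//; exact: truncnS_gt.
have lle k : a * (l k)%:R <= sigma * k%:R + c + a.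
  rewrite /l -natr1 mulrDr mulr1 lerD2r mulrC -ler_pdivlMr// truncn_le.
  by rewrite divr_ge0 ?(ltW a_gt0)// addr_ge0// mulr_ge0.
have l_phi k : CC * expR (- a * (l k)%:R) < expR (- sigma * k%:R).
  rewrite -[X in X * _]lnK ?posrE// -expRD ltr_expR.
  have := lgt k; have := ler_norm (ln CC); have := normr_ge0 (ln (CC / eta)).
  by rewrite /c; lra.
have l_eta k : CC * expR (- a * (l k)%:R) <= eta.
  rewrite mulrC -ler_pdivlMr// -[leRHS]invf_div -[X in _ <= X^-1](lnK CCe).
  rewrite -expRN ler_expR.
  have := lgt k; have := ler_norm (ln (CC / eta)); have := normr_ge0 (ln CC).
  have : 0 <= sigma * k%:R by rewrite mulr_ge0.
  by rewrite /c; lra.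
(* Sparseness by the factor [Q.+1] yields [ln D * N i <= gap * k i.+1], where [N i] is
   [k i + m i]. *)
pose Q := Num.truncn (ln D%:R / gap).
have QP : ln D%:R < gap * Q.+1%:R.
  by rewrite mulrC -ltr_pdivrMr//; exact: truncnS_gt.
have := @exists_stages (fun=> l) (l 0%N) Q
  (fun j n => expR (- sigma * n%:R) <= phi j n) phiP.
move=> [k [m [k0 m0 km kphi mE]]].
have mlE i : m i = l (k i) by case: i => [|i]; rewrite ?mE// m0 k0.
pose zz i := if i is i'.+1 then z (logn 2 i'.+1).+1 (k i'.+1) else x0.
have Nk i : (k i + m i < k i.+1)%N.
  by apply: leq_ltn_trans (km i); rewrite -[leqLHS]mul1n leq_mul2r orbT.
have lims xp := @path_limit R X f D a C r0 x0 k m zz f_degree a_gt0 C_gt0 r0_gt0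
  f_back X_bounded Nk b C' xp C'_gt0 f_forw X_complete.
have D1 : 0 <= ln D%:R :> R by rewrite ln_ge0// ler1n.
apply: (bowen_measure_path_limits (k := k) (l := m) (zz := zz) (c0 := t * (c / a + 1)) D_gt0 f_inj a_gt0 C_gt0 r0_gt0 k0 _ Nk _ lims _ t0) => //.
- by move=> i; rewrite mlE; exact: l_eta.
- apply: (path_limits_in_targets (k := k) (m := m)) => [i|i y yP|i].
  + by apply: leq_ltn_trans (Nk i); exact: leq_addr.
  + exact: (path_limits_target (zz := zz) k0 erefl Nk i.+1 yP).
  + by rewrite mlE; apply: lt_le_trans (kphi i).
- by move: gap0; rewrite /gap; have := mulr_ge0 t0 sa0; lra.
- move=> i.
  have Nle : t * (k i + m i)%:R <= t * (1 + sigma / a) * (k i)%:R + t * (c / a + 1).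
    rewrite natrD mlE -mulrA -mulrDr ler_wpM2l//.
    have : (l (k i))%:R <= (sigma * (k i)%:R + c + a) / a.
      by rewrite ler_pdivlMr// mulrC.
    by rewrite !mulrDl divff ?gt_eqF//; lra.
  apply: le_trans Nle _; rewrite lerD2r.
  case: i => [|i]; first by rewrite k0 mulr0 mulr_ge0.
  (* Only the last stage of branching is kept; sparseness makes it dominant. *)
  have hle : (k i.+1 - (k i + m i) <= height k m 0 i.+1)%N.
    by rewrite /height big_ord_recr /= add0n leq_addl.
  apply: le_trans (_ : ln D%:R * (k i.+1 - (k i + m i))%:R <= _); last first.
    by rewrite ler_wpM2l// ler_nat.
  rewrite natrB ?(ltnW (Nk i))//.
  have h1 : gap * Q.+1%:R * (k i + m i)%:R <= gap * (k i.+1)%:R.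
    by rewrite -mulrA ler_wpM2l ?(ltW gap0)// -natrM ler_nat ltnW.
  have h2 : ln D%:R * (k i + m i)%:R <= gap * Q.+1%:R * (k i + m i)%:R.
    by rewrite ler_wpM2r// ltW.
  by move: h1 h2; rewrite /gap; lra.
Qed.

End ShrinkingTargets.

(** * Growth of matrix powers *)

Section MatrixPowers.
Context {R : realType} {n : nat}.
Implicit Types (s : seq R[i]) (b : R).

Lemma normc_ge0 (x : R[i]) : 0 <= normc x.
Proof. by case: x => x y; exact: sqrtr_ge0. Qed.

Lemma normc_real (x : R) : normc x%:C%C = `|x|.
Proof. by rewrite /normc/= expr0n addr0 sqrtr_sqr. Qed.

Lemma horner_mx_XsubC (M : 'M[R[i]]_n.+1) x : horner_mx M ('X - x%:P) = M - x%:M.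
Proof. by rewrite rmorphB/= horner_mx_X horner_mx_C. Qed.

Lemma scalar_mx_mul (T : pzRingType) m (x : T) (W : 'M[T]_m) : x%:M * W = x *: W.
Proof. exact: mul_scalar_mx. Qed.

(* Induction on the roots: the sequence [M^N (M - x) W] is [b^N]-bounded, and
   [M^(N+1) W = x M^N W + M^N (M - x) W]. *)
Lemma normc_powers_le (M W : 'M[R[i]]_n.+1) s b :
  0 < b -> (forall x, x \in s -> normc x < b) ->
  horner_mx M (\prod_(x <- s) ('X - x%:P)) * W = 0 ->
  exists2 K, 0 <= K & forall N i j, normc ((M ^+ N * W) i j) <= K * b ^+ N.
Proof.
move=> b0; elim: s W => [|x s IHs] W sb.
  rewrite big_nil rmorph1 mul1r => ->; exists 0 => // N i j.
  by rewrite mulr0 mxE normc0 mul0r.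
rewrite big_cons mulrC rmorphM/= -mulrA => /IHs[|C C0 CP].
  by move=> y ys; apply: sb; rewrite inE ys orbT.
have xb : 0 < b - normc x by rewrite subr_gt0 sb// mem_head.
pose K0 := \sum_i \sum_j normc (W i j).
have K00 : 0 <= K0.
  by apply: sumr_ge0 => i _; apply: sumr_ge0 => j _; exact: normc_ge0.
have Cb : 0 <= C / (b - normc x) by rewrite divr_ge0// ltW.
exists (K0 + C / (b - normc x)); first exact: addr_ge0.
move=> N i j; elim: N => [|N IHN].
  rewrite expr0 mul1r mulr1; apply: le_trans (_ : K0 <= _); last by rewrite lerDl.
  rewrite /K0 (bigD1 i)//= (bigD1 j)//= -addrA lerDl addr_ge0//.
    by apply: sumr_ge0 => *; exact: normc_ge0.
  by apply: sumr_ge0 => *; apply: sumr_ge0 => *; exact: normc_ge0.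
have -> : (M ^+ N.+1 * W) i j =
    x * (M ^+ N * W) i j + (M ^+ N * (horner_mx M ('X - x%:P) * W)) i j.
  rewrite horner_mx_XsubC mulrBl mulrBr mulrA -exprSr.
  rewrite scalar_mx_mul -scalerAr.
  by move: (M ^+ _ * W) (M ^+ N * W) => P Q; rewrite !mxE; ring.
apply: le_trans (le_normcD _ _) _; rewrite normcM.
have := ler_wpM2l (normc_ge0 x) IHN; have := CP N i j.
have : C * b ^+ N = (b - normc x) * (C / (b - normc x)) * b ^+ N.
  by rewrite [(b - _) * _]mulrC divfK ?gt_eqF.
have bN : 0 < b ^+ N by rewrite exprn_gt0.
have : 0 <= K0 * (b - normc x) * b ^+ N by rewrite !mulr_ge0// ltW.
rewrite exprS; set y := C / _; lra.
Qed.

Lemma enorm_le_sum (v : 'cV[R]_n.+1) : enorm v <= \sum_i `|v i 0|.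
Proof.
have S0 : 0 <= \sum_i `|v i 0| by apply: sumr_ge0.
rewrite -[leRHS]ger0_norm// -sqrtr_sqr ler_sqrt ?sqr_ge0//.
rewrite expr2 mulr_suml; apply: ler_sum => i _.
rewrite -real_normK ?num_real// expr2 ler_wpM2l// (bigD1 i)//= lerDl.
by apply: sumr_ge0.
Qed.

Lemma enorm_mulmx_le (M : 'M[R]_n.+1) (v : 'cV[R]_n.+1) (c : R) :
  (forall i j, `|M i j| <= c) ->
  enorm (M *m v) <= (n.+1 ^ 2)%:R * c * enorm v.
Proof.
move=> Mc; apply: le_trans (enorm_le_sum _) _.
apply: le_trans (_ : \sum_(i < n.+1) n.+1%:R * c * enorm v <= _); last first.
  by rewrite sumr_const card_ord -[leLHS]mulr_natl natrX expr2 !mulrA.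
apply: ler_sum => i _; rewrite mxE; apply: le_trans (ler_norm_sum _ _ _) _.
apply: le_trans (_ : \sum_(j < n.+1) c * enorm v <= _); last first.
  by rewrite sumr_const card_ord -[leLHS]mulr_natl mulrA.
apply: ler_sum => j _; rewrite normrM ler_pM//; exact: coord_le_enorm.
Qed.

Lemma enorm_powers_le (M : 'M[R]_n.+1) s b :
  0 < b -> (forall x, x \in s -> normc x < b) ->
  horner_mx (map_mx (real_complex R) M) (\prod_(x <- s) ('X - x%:P)) = 0 ->
  exists2 C, 0 < C & forall N (v : 'cV[R]_n.+1),
    enorm (M ^+ N *m v) <= C * b ^+ N * enorm v.
Proof.
move=> b0 sb sM; have [|K K0 KP] := @normc_powers_le (map_mx (real_complex R) M) 1 s b b0 sb.
  by rewrite mulr1.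
exists ((n.+1 ^ 2)%:R * (K + 1)) => [|N v].
  by rewrite mulr_gt0// ltr_wpDl.
rewrite -[_ * _ * b ^+ N]mulrA; apply: enorm_mulmx_le => i j.
have := KP N i j; rewrite mulr1 -rmorphXn/= mxE normc_real => /le_trans; apply.
by rewrite ler_wpM2r ?exprn_ge0 ?(ltW b0)// lerDl.
Qed.

Lemma horner_mx_prod_cons (M W : 'M[R[i]]_n.+1) (g : R[i] -> R[i]) x s :
  horner_mx M (\prod_(y <- x :: s) ('X - (g y)%:P)) * W =
  horner_mx M (\prod_(y <- s) ('X - (g y)%:P)) * (horner_mx M ('X - (g x)%:P) * W).
Proof. by rewrite big_cons mulrC rmorphM/= mulrA. Qed.

(** Factor by factor, [M^-1 - x^-1 = - x^-1 M^-1 (M - x)], and the extra powers of [M^-1] commute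
    past the product. *)
Lemma horner_mx_inv_roots (M W : 'M[R[i]]_n.+1) s : M \in unitmx ->
  (forall x, x \in s -> x != 0) ->
  horner_mx M (\prod_(x <- s) ('X - x%:P)) * W = 0 ->
  horner_mx (invmx M) (\prod_(x <- s) ('X - (x^-1)%:P)) * W = 0.
Proof.
move=> uM; elim: s W => [|x s IHs] W s0; first by rewrite !big_nil !rmorph1.
rewrite (horner_mx_prod_cons _ _ id) (horner_mx_prod_cons _ _ GRing.inv) => /IHs MW.
have x0 : x != 0 by rewrite s0// mem_head.
have {MW} MW := MW (fun y ys => s0 y (mem_behead (s := x :: s) ys)).
have -> : horner_mx (invmx M) ('X - (x^-1)%:P) * W =
    - x^-1 *: (invmx M * (horner_mx M ('X - x%:P) * W)).
  rewrite !horner_mx_XsubC !mulrBl mulrBr mulrA -[invmx M * M]/(invmx M *m M) mulVmx//.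
  rewrite mul1r !scalar_mx_mul -scalerAr.
  by rewrite scalerBr scalerA mulNr mulVf// !scaleNr scale1r opprK addrC.
rewrite -scalerAr mulrA.
have -> : horner_mx (invmx M) (\prod_(y <- s) ('X - (y^-1)%:P)) * invmx M =
    invmx M * horner_mx (invmx M) (\prod_(y <- s) ('X - (y^-1)%:P)).
  exact: (comm_horner_mx _ (comm_mx_refl (invmx M))).
by rewrite -mulrA MW mulr0 scaler0.
Qed.

Lemma enorm_inv_powers_le (M : 'M[R]_n.+1) s b : M \in unitmx -> 0 < b ->
  (forall x, x \in s -> x != 0) -> (forall x, x \in s -> normc x^-1 < b) ->
  horner_mx (map_mx (real_complex R) M) (\prod_(x <- s) ('X - x%:P)) = 0 ->
  exists2 C, 0 < C & forall N (v : 'cV[R]_n.+1),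
    enorm (invmx M ^+ N *m v) <= C * b ^+ N * enorm v.
Proof.
move=> uM b0 s0 sb sM.
apply: (@enorm_powers_le _ [seq x^-1 | x <- s]) => //.
  by move=> _ /mapP[x xs ->]; exact: sb.
rewrite big_map map_invmx -[LHS]mulr1; apply: horner_mx_inv_roots => //.
  by rewrite map_unitmx.
by rewrite mulr1.
Qed.

Lemma normc_intr (m : int) : normc (m%:~R : R[i]) = `|m|%:R.
Proof.
by rewrite -(rmorph_int (real_complex R)) normc_real -intr_norm -abszE.
Qed.

Lemma normc_prod (I : Type) (r : seq I) (F : I -> R[i]) :
  normc (\prod_(i <- r) F i) = \prod_(i <- r) normc (F i).
Proof. by rewrite (big_morph (@normc R) (@normcM R) (@normc1 R)). Qed.

Lemma normc_signM m (x : R[i]) : normc ((-1) ^+ m * x) = normc x.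
Proof.
elim: m => [|m IHm]; first by rewrite mul1r.
by rewrite exprS -mulrA normcM IHm [normc (-1)](normcN (1 : R[i])) normc1 mul1r.
Qed.

(** The constant coefficient of the characteristic polynomial is, up to sign, both the determinant
    and the product of the eigenvalues. *)
Lemma ln_absz_det (A : 'M[int]_n.+1) (lam : 'I_n.+1 -> R[i]) :
  char_poly (map_mx intr A) = \prod_i ('X - (lam i)%:P) ->
  (forall i, 0 < normc (lam i)) ->
  ln (`|\det A|%:R : R) = \sum_i ln (normc (lam i)).
Proof.
move=> charA lam0.
have -> : `|\det A|%:R = \prod_i normc (lam i) :> R.
  rewrite -normc_intr -det_map_mx/= -(normc_signM n.+1) -char_poly_det charA.
  rewrite -horner_coef0 horner_prod normc_prod; apply: eq_bigr => i _.
  by rewrite !hornerE; exact: normcN.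
suff [] : 0 < \prod_i normc (lam i) /\
  ln (\prod_i normc (lam i)) = \sum_i ln (normc (lam i)) by [].
apply: (big_rec2 (fun x y => 0 < x /\ ln x = y)) => [|i x y _ [x0 <-]].
  by rewrite ln1.
by rewrite mulr_gt0// lnM ?posrE.
Qed.

End MatrixPowers.

(** * Toral endomorphisms *)

Section TorusEndomorphism.
Context {R : realType} {n : nat}.
Implicit Types (x y z : torus R n.+1) (v w : 'cV[R]_n.+1) (A : 'M[int]_n.+1).

Local Notation Z2R := (map_mx (intr : int -> R)).

Lemma torus_pi_eqP v w : torus_pi v = torus_pi w <-> exists k, v = w + Z2R k.
Proof.
rewrite torus_pi_eq; split=> [h|[k ->] i]; last first.
  by rewrite !mxE addrAC subrr add0r intr_int.
have /choice[k kP] : forall i, exists m : int, v i 0 - w i 0 = m%:~R.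
  by move=> i; apply/intrP.
by exists (\col_i k i); apply/colP => i; rewrite !mxE -kP addrC subrK.
Qed.

Lemma int_lattice_small (k : 'cV[int]_n.+1) : enorm (Z2R k) < 1 -> k = 0.
Proof.
move=> k1; apply/colP => i; rewrite mxE.
have := le_lt_trans (coord_le_enorm (Z2R k) i) k1.
by rewrite mxE -intr_norm -[1]/(1%:~R) ltr_int; lia.
Qed.

Lemma iter_torus_endo A N v :
  iter N (torus_endo A) (torus_pi v) = torus_pi (Z2R A ^+ N *m v).
Proof.
elim: N => [|N IHN]; first by rewrite mul1mx.
by rewrite iterS IHN torus_endoE mulmxA exprS.
Qed.

Lemma torus_dist_pi_le v w : mdist (torus_pi v) (torus_pi w) <= enorm (v - w).
Proof. by apply: torus_dist_le; rewrite torus_piD torus_piN. Qed.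

Lemma torus_dist_ltP x y r : mdist x y < r ->
  exists u v, [/\ x = torus_pi u, y = torus_pi (u - v) & enorm v < r].
Proof.
move=> /torus_dist_lt[v vxy vr]; exists (repr x), v; split=> //.
  by rewrite torus_pi_repr.
by rewrite torus_piD torus_piN torus_pi_repr vxy subKr.
Qed.

Lemma torus_endo_forward A (b C : R) : 0 < C ->
  (forall N v, enorm (Z2R A ^+ N *m v) <= C * expR b ^+ N * enorm v) ->
  forward_expanding (torus_endo A : torus R n.+1 -> _) b C.
Proof.
move=> C0 AC N x y; apply/ler_addgt0Pr => e e0.
have K0 : 0 < C * expR (b * N%:R) by rewrite mulr_gt0 ?expR_gt0.
have [|u [v [-> -> ve]]] :=
    @torus_dist_ltP x y (mdist x y + e / (C * expR (b * N%:R))).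
  by rewrite ltrDl divr_gt0.
rewrite !iter_torus_endo; apply: le_trans (torus_dist_pi_le _ _) _.
rewrite -mulmxBr opprB addrC subrK; apply: le_trans (AC N v) _.
rewrite -expRM_natr; apply: le_trans (ler_wpM2l (ltW K0) (ltW ve)) _.
by rewrite mulrDr [_ * (e / _)]mulrC divfK ?gt_eqF.
Qed.

Lemma unitmx_intr A : \det A != 0 -> Z2R A \in unitmx.
Proof. by move=> A0; rewrite unitmxE det_map_mx unitfE intr_eq0. Qed.

(** If [v] is a short lift of the difference between the [N]-th image of [x] and [w], subtracting
    [A^-N v] from a lift of [x] gives the shadowing point; at time [j] the difference is
    [A^-(N - j) v]. *)
Lemma torus_endo_backward A (a C : R) : 0 < C -> \det A != 0 ->
  (forall N v, enorm (invmx (Z2R A) ^+ N *m v) <= C * expR (- a) ^+ N * enorm v) ->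
  backward_contracting (torus_endo A : torus R n.+1 -> _) a C.
Proof.
move=> C0 /unitmx_intr uA AC N x w r xwr.
have AN m : Z2R A ^+ m *m invmx (Z2R A) ^+ m = 1%:M.
  rewrite -[_ *m _]/(_ * _) -exprMn_comm; last first.
    by rewrite /GRing.comm -[LHS]/(_ *m _) -[RHS]/(_ *m _) mulmxV// mulVmx.
  by rewrite -[_ * _]/(_ *m _) mulmxV// expr1n.
have [u [v [xu -> vr]]] := torus_dist_ltP xwr.
have -> : x = torus_pi (repr x) by rewrite torus_pi_repr.
set x' := repr x; exists (torus_pi (x' - invmx (Z2R A) ^+ N *m v)).
  rewrite iter_torus_endo mulmxBr mulmxA AN mul1mx.
  by rewrite !torus_piD -xu -iter_torus_endo torus_pi_repr.
move=> j jN; rewrite !iter_torus_endo.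
apply: le_trans (torus_dist_pi_le _ _) _.
rewrite -mulmxBr opprB addrC subrK.
have -> : Z2R A ^+ j *m (invmx (Z2R A) ^+ N *m v) = invmx (Z2R A) ^+ (N - j) *m v.
  by rewrite mulmxA -{1}(subnKC jN) exprD -[_ ^+ j * _]/(_ *m _) mulmxA AN mul1mx.
apply: le_trans (AC _ _) _; rewrite -expRM_natr ler_wpM2l ?ltW//.
by rewrite mulr_gt0// expR_gt0.
Qed.

(** For a short lift [v] of the difference of two points with equal image, [A v] is an integer
    vector of norm below 1, hence zero, and [A] is invertible over the reals. *)
Lemma torus_endo_injective_at_scale A : \det A != 0 ->
  exists2 delta, 0 < delta & injective_at_scale (torus_endo A : torus R n.+1 -> _) delta.
Proof.
move=> /unitmx_intr uA.
pose c : R := \sum_i \sum_j `|Z2R A i j|.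
have Ac i j : `|Z2R A i j| <= c.
  rewrite /c (bigD1 i)//= (bigD1 j)//= -addrA lerDl addr_ge0//.
    by apply: sumr_ge0.
  by apply: sumr_ge0 => *; apply: sumr_ge0.
have c0 : 0 <= c by apply: sumr_ge0 => *; apply: sumr_ge0.
pose K := (n.+1 ^ 2)%:R * c + 1.
have K0 : 0 < K by rewrite ltr_wpDl// mulr_ge0.
exists K^-1; first by rewrite invr_gt0.
move=> x y /torus_dist_ltP[u [v [-> -> vK]]].
rewrite !torus_endoE mulmxBr => /torus_pi_eqP[k].
move/(congr1 (fun t => t - Z2R A *m u)); rewrite subrr addrAC [_ - _ - _]addrAC subrr add0r.
move=> /eqP; rewrite eq_sym addrC subr_eq0 => /eqP kE.
have k0 : k = 0.
  apply: int_lattice_small; rewrite kE; apply: le_lt_trans (enorm_mulmx_le _ Ac) _.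
  apply: le_lt_trans (_ : K * enorm v < _).
    by rewrite ler_wpM2r ?enorm_ge0// lerDl.
  by rewrite -ltr_pdivlMl// mulr1.
have -> : v = 0.
  by rewrite -[v]mul1mx -(mulVmx uA) -mulmxA -kE k0 map_mx0 mulmx0.
by rewrite subr0.
Qed.

Lemma torus_bounded : exists2 r0 : R, 0 < r0 & forall x y, mdist x y < r0.
Proof.
exists n.+2%:R => // x y.
pose v := repr (x - y).
pose k : 'cV[int]_n.+1 := \col_i Num.floor (v i 0).
have vk : torus_pi (v - Z2R k) = x - y.
  rewrite -[RHS]torus_pi_repr; apply/torus_pi_eqP; exists (- k).
  by rewrite map_mxN.
apply: le_lt_trans (torus_dist_le vk) _.
apply: le_lt_trans (enorm_le_sum _) _.
apply: le_lt_trans (_ : n.+1%:R < _); last by rewrite ltr_nat.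
rewrite -[X in _ <= X%:R]card_ord -sumr_const; apply: ler_sum => i _.
rewrite !mxE; have /andP[h1 h2] := floor_itv (v i 0).
by rewrite ger0_norm ?subr_ge0// lerBlDr addrC -intrD1 ltW.
Qed.

(** Late terms are lifted within [1 / 4] of one fixed vector. Two such lifts at toral distance below
    [1 / 2] then differ from a short lift of the difference by an integer vector of norm below 1, so
    the lifts themselves are Cauchy and converge coordinatewise. *)
Lemma torus_complete : cauchy_complete (torus R n.+1).
Proof.
move=> u cu.
have [P PP] := cu (1 / 4) ltac:(lra).
pose V0 := repr (u P).
have lift p : {V | torus_pi V = u p /\ ((P <= p)%N -> enorm (V0 - V) < 1 / 4)}.
  apply: cid; have [Pp|pP] := leqP P p; last by exists (repr (u p)); rewrite torus_pi_repr.
  have [v vP v4] := torus_dist_lt (PP P p (leqnn _) Pp).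
  exists (V0 - v); split; last by rewrite subKr.
  by rewrite torus_piD torus_piN torus_pi_repr vP subKr.
pose V p := projT1 (lift p).
have Vpi p : torus_pi (V p) = u p by have [] := projT2 (lift p).
have VP p : (P <= p)%N -> enorm (V0 - V p) < 1 / 4 by have [_] := projT2 (lift p).
have V_cauchy e : 0 < e -> e <= 1 / 2 -> exists Q, forall p q, (Q <= p)%N -> (Q <= q)%N ->
    enorm (V p - V q) < e.
  move=> e0 e2; have [Q QP] := cu e e0; exists (maxn P Q) => p q.
  rewrite !geq_max => /andP[Pp Qp] /andP[Pq Qq].
  have [v vpq ve] := torus_dist_lt (QP p q Qp Qq).
  have : torus_pi (V p - V q) = torus_pi v.
    by rewrite torus_piD torus_piN !Vpi.
  move=> /torus_pi_eqP[k kE]; suff k0 : k = 0.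
    by rewrite kE k0 map_mx0 addr0.
  apply: int_lattice_small.
  have -> : Z2R k = (V0 - V q) + (- (V0 - V p) + - v).
    apply/colP => i; move/colP: kE => /(_ i); rewrite !mxE; lra.
  apply: le_lt_trans (enormD _ _) _.
  have := enormD (- (V0 - V p)) (- v); rewrite !enormN.
  by have := VP p Pp; have := VP q Pq; lra.
have /choice[l lP] : forall i : 'I_n.+1, exists li : R, (fun p => V p i 0) @ \oo --> li.
  move=> i; apply/cvg_ex; apply/cauchy_cvgP/cauchy_exP => e e0.
  have [||Q QP] := V_cauchy (Num.min e (1 / 2)).
  - by rewrite lt_min e0/=; lra.
  - by rewrite ge_min lexx orbT.
  exists (V Q i 0); exists Q => // p Qp /=.
  rewrite /ball/=; have := coord_le_enorm (V Q - V p) i; rewrite !mxE => /le_lt_trans; apply.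
  by apply: lt_le_trans (QP Q p (leqnn _) Qp) _; rewrite ge_min lexx.
exists (torus_pi (\col_i l i)) => e e0.
have e' : 0 < e / n.+2%:R by rewrite divr_gt0.
have /choice[Q QP] : forall i, exists Q, forall p, (Q <= p)%N -> `|V p i 0 - l i| < e / n.+2%:R.
  move=> i; have /cvgrPdist_lt/(_ _ e')[Q _ QP] := lP i.
  by exists Q => p Qp; rewrite distrC; exact: QP.
exists (\max_i Q i) => p Qp; rewrite -Vpi; apply: le_lt_trans (torus_dist_pi_le _ _) _.
apply: le_lt_trans (enorm_le_sum _) _.
apply: le_lt_trans (_ : \sum_(i < n.+1) e / n.+2%:R < _).
  apply: ler_sum => i _; rewrite !mxE ltW// QP// (leq_trans _ Qp)//.
  exact: leq_bigmax.
rewrite sumr_const card_ord -[ltLHS]mulr_natr mulrAC ltr_pdivrMr//.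
by rewrite ltr_pM2l// ltr_nat.
Qed.

End TorusEndomorphism.

(** * Number of preimages under a toral endomorphism *)

Section TorusDegree.
Context {R : realType} {n : nat}.

Local Notation Z2R := (map_mx (intr : int -> R)).

Lemma absz_unit (u : int) : u \is a GRing.unit -> `|u|%N = 1%N.
Proof. by rewrite unfold_in /= => /orP[/eqP->|/eqP->]. Qed.

Let Z2R_inj m p : injective (fun M : 'M[int]_(m, p) => Z2R M).
Proof.
move=> v w /matrixP vw; apply/matrixP => i j.
by move: (vw i j); rewrite !mxE; exact: intr_inj.
Qed.

(* With the Smith normal form [A = L *m Dg *m U], the classes of [Z^n / A Z^n]
   are represented by [L *m r], where [0 <= r i < |d_i|]. *)
Lemma torus_endo_degree (A : 'M[int]_n.+1) : \det A != 0 ->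
  has_degree (torus_endo A : torus R n.+1 -> _) `|\det A|%N.
Proof.
move=> A0 z; have uA : Z2R A \in unitmx := unitmx_intr A0.
have [L uL [U uU [ds _ AE]]] := int_Smith_normal_form A.
set Dg := (\matrix_(i, j) _) in AE.
pose d (i : 'I_n.+1) := ds`_i.
have DgE (v : 'cV[int]_n.+1) i : (Dg *m v) i 0 = d i * v i 0.
  rewrite mxE (bigD1 i)//= big1 ?addr0; first by rewrite mxE eqxx mulr1n.
  by move=> j ji; rewrite mxE (_ : (i == j :> nat) = false) ?mul0r//; apply/negbTE; rewrite eq_sym.
have detE : `|\det A|%N = (\prod_i `|d i|)%N.
  rewrite !unitmxE in uL uU; rewrite AE !det_mulmx !abszM.
  rewrite (absz_unit uL) (absz_unit uU) mul1n muln1.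
  have -> : Dg = diag_mx (\row_i d i).
    by apply/matrixP => i j; rewrite !mxE.
  rewrite det_diag (big_morph absz abszM (erefl _ : `|1%Z|%N = 1%N)).
  by apply: eq_bigr => i _; rewrite mxE.
have d0 i : d i != 0.
  apply: contraNneq A0 => di0; rewrite -absz_eq0 detE (bigD1 i)//= di0.
  by rewrite absz0 mul0n.
pose T := {dffun forall i : 'I_n.+1, 'I_`|d i|}.
pose vec (r : T) : 'cV[int]_n.+1 := \col_i (val (r i))%:Z.
pose pt (r : T) : torus R n.+1 :=
  torus_pi (invmx (Z2R A) *m (repr z + Z2R (L *m vec r))).
exists [seq pt r | r <- enum {: T}]; split.
- rewrite map_inj_in_uniq ?enum_uniq// => r r' _ _ /torus_pi_eqP[k kE].
  have {}kE : L *m vec r = L *m vec r' + A *m k.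
    apply: Z2R_inj; rewrite /= map_mxD [Z2R (A *m k)]map_mxM.
    apply: (@addrI _ (repr z)); rewrite addrA.
    apply: (can_inj (mulKVmx uA)).
    by rewrite kE [in RHS]mulmxDr mulKmx.
  have {}kE : vec r = vec r' + Dg *m (U *m k).
    apply: (can_inj (mulKmx uL)); rewrite kE mulmxDr; congr (_ + _).
    by rewrite [in LHS]AE !mulmxA.
  apply/ffunP => i; apply: val_inj; apply/eqP/negPn/negP => ri.
  (* Two residues differing by a multiple of [d i] are equal, both being below its absolute
     value. *)
  have e : (val (r i))%:Z - (val (r' i))%:Z = d i * (U *m k) i 0.
    rewrite -DgE; move: kE; move: (Dg *m (U *m k)) => v /colP/(_ i).
    by rewrite !mxE => ->; rewrite addrAC subrr add0r.
  have /dvdn_leq : (`|d i| %| `|(val (r i))%:Z - (val (r' i))%:Z|)%N.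
    by rewrite e abszM dvdn_mulr.
  have rd := ltn_ord (r i); have r'd := ltn_ord (r' i).
  by move: ri rd r'd => /=; lia.
- rewrite size_map -cardE card_dep_ffun foldrE big_image /= detE.
  by apply: eq_bigr => i _; rewrite card_ord.
- move=> x; apply/mapP/eqP => [[r _ ->]|fx].
    rewrite torus_endoE mulKVmx// -[RHS]torus_pi_repr; apply/torus_pi_eqP.
    by exists (L *m vec r).
  move: fx; rewrite -[x in LHS]torus_pi_repr torus_endoE -[RHS]torus_pi_repr.
  move=> /torus_pi_eqP[q qE].
  (* Euclidean division of these coordinates by the [d i] yields the representative [r] and the
     integer correction [kk]. *)
  pose rq := invmx L *m q.
  have rq_lt i : (`|(rq i 0%R %% d i)%Z| < `|d i|)%N.
    by rewrite -ltz_nat !abszE ger0_norm ?modz_ge0// ltz_mod.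
  pose r : T := [ffun i => Ordinal (rq_lt i)].
  pose kk : 'cV[int]_n.+1 := \col_i (rq i 0%R %/ d i)%Z.
  have qE' : q = L *m vec r + A *m (invmx U *m kk).
    rewrite [in RHS]AE -!mulmxA mulKVmx// -mulmxDr -[LHS](mulKVmx uL); congr (_ *m _).
    rewrite -/rq; apply/colP => i; rewrite [in RHS]mxE DgE [vec r i 0]mxE [kk i 0]mxE ffunE/= abszE ger0_norm ?modz_ge0//.
    by rewrite addrC mulrC -divz_eq.
  exists r; first by rewrite mem_enum.
  rewrite -[x]torus_pi_repr; apply/torus_pi_eqP; exists (invmx U *m kk).
  rewrite -[LHS](mulKmx uA) qE qE' map_mxD [Z2R (A *m _)]map_mxM addrA mulmxDr.
  by rewrite [in LHS]mulKmx.
Qed.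

End TorusDegree.

(** * Diameters of Bowen balls *)

Section BowenBallContraction.
Context {R : realType} {X : metricType R}.

(* Backward shadowing produces a preimage of [f^(n-1) y'] close to [y] along the
   whole orbit; local injectivity identifies it with [y']. *)
Lemma bowen_ball_contracting (f : X -> X) (a C r0 delta : R) :
  0 < delta -> injective_at_scale f delta -> 0 < a -> 0 < C -> 0 < r0 ->
  backward_contracting f a C -> (forall x y : X, mdist x y < r0) ->
  exists eps K, [/\ 0 < eps, 0 < K & forall n x y y',
    bowen_ball f n x eps y -> bowen_ball f n x eps y' ->
    mdist y y' <= K * expR (- a * n%:R)].
Proof.
move=> d0 f_inj a0 C0 r00 f_back Xr0.
(* Chosen so that [2 * eps + C * (2 * eps)] is [delta / 2]. *)
pose eps := delta / (4 * (1 + C)).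
have C1 : 0 < 4 * (1 + C) by rewrite mulr_gt0// addr_gt0.
have e0 : 0 < eps by exact: divr_gt0.
have epsE : eps * (4 * (1 + C)) = delta by rewrite divfK// gt_eqF.
have K0 : 0 < C * expR a * (2 * eps).
  exact: mulr_gt0 (mulr_gt0 C0 (expR_gt0 a)) (mulr_gt0 (ltr0Sn _ _) e0).
(* A ball of order [n.+1] controls orbits only up to time [n], which costs the factor [expR a]; the
   term [r0] covers order 0. *)
exists eps, (C * expR a * (2 * eps) + r0); split=> //; first exact: addr_gt0.
move=> [|n] x y y' By By'.
  rewrite mulr0 expR0 mulr1; apply: le_trans (ltW (Xr0 _ _)) _.
  by rewrite lerDr; exact: ltW.
have close j : (j < n.+1)%N -> mdist (iter j f y) (iter j f y') < 2 * eps.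
  move=> jn; apply: le_lt_trans (metric_triangle _ (iter j f x) _) _.
  by rewrite metric_sym mulrDl mul1r ltrD ?By ?By'.
have [y2 y2E yy2] := f_back n y (iter n f y') (2 * eps) (close n (ltnSn n)).
have e2 : 0 < 2 * eps by rewrite mulr_gt0.
have bound j : (j <= n)%N -> mdist (iter j f y) (iter j f y2) <= C * (2 * eps).
  move=> jn; apply: le_trans (yy2 j jn) _; rewrite ler_pM2r// ger_pMr//.
  by rewrite expR_le1 mulNr oppr_le0 mulr_ge0// ltW.
have <- : y2 = y'.
  apply: (@iter_inj_at_scale R X f delta f_inj n) => // j jn.
  apply: le_lt_trans (metric_triangle _ (iter j f y) _) _.
  have := close j (ltnW jn); have := bound j (ltnW jn).
  rewrite (metric_sym (iter j f y2)) -epsE.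
  by move: e0 (mulr_gt0 C0 e0); lra.
have := yy2 0%N isT; rewrite subn0 => /le_trans; apply.
rewrite [leRHS]mulrDl; apply: ler_wpDr; first by rewrite mulr_ge0 ?expR_ge0// ltW.
have -> : expR (- a * n.+1%:R) = expR (- a * n%:R) / expR a.
  by rewrite -expRN -expRD -[n.+1%:R]natr1 mulrDr mulr1.
have : expR a != 0 by rewrite gt_eqF ?expR_gt0.
set E := expR (- a * n%:R); move=> ea.
by rewrite (_ : C * expR a * _ * _ = C * E * (2 * eps))//; field.
Qed.

End BowenBallContraction.

(** * Exponential decay rates of the radii *)

Section LowerOrder.
Context {R : realType}.
Implicit Types (phi : nat -> R) (u : nat -> \bar R).
Local Open Scope ereal_scope.

Lemma limn_einf_ltP u (s : \bar R) K : limn_einf u < s -> exists2 k, (K <= k)%N & u k < s.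
Proof.
rewrite limn_einf_lim (cvg_lim _ (ereal_nondecreasing_cvgn (nondecreasing_einfs u)))//.
move=> us; have /le_lt_trans/(_ us) : einfs u K <= ereal_sup (range (einfs u)).
  by apply: ereal_sup_ubound; exists K.
by move=> /ereal_inf_lt[_ [k Kk <-] uks]; exists k.
Qed.

Lemma lt_limn_einfP u (s : \bar R) : s < limn_einf u ->
  exists K, forall k, (K <= k)%N -> s < u k.
Proof.
rewrite limn_einf_lim (cvg_lim _ (ereal_nondecreasing_cvgn (nondecreasing_einfs u)))//.
move=> /ereal_sup_gt[_ [K _ <-] sK]; exists K => k Kk.
by apply: lt_le_trans sK _; apply: ereal_inf_lbound; exists k.
Qed.

Lemma limn_einf_ge0 u : (forall k, 0 <= u k) -> 0 <= limn_einf u.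
Proof.
move=> u0; rewrite leNgt; apply/negP => /(limn_einf_ltP 0)[k _].
by rewrite ltNge u0.
Qed.

Lemma order_lt_frequently phi (sigma : R) K : (forall k, 0 < phi k)%R ->
  limn_einf (fun k => (- ln (phi k) / k%:R)%:E) < sigma%:E ->
  exists2 k, (K <= k)%N & (expR (- sigma * k%:R) <= phi k)%R.
Proof.
(* Starting at [K.+1] excludes the time 0, at which the quotient is a division by zero. *)
move=> phi0 /(limn_einf_ltP K.+1)[k Kk]; rewrite lte_fin => phik.
exists k; first exact: ltnW.
have k0 : (0 < k%:R :> R)%R by rewrite ltr0n (leq_trans _ Kk).
rewrite -[leRHS]lnK ?posrE// ler_expR mulNr lerNl ltW//.
by rewrite -ltr_pdivrMr.
Qed.

Lemma order_gt_eventually phi (sigma : R) : (forall k, 0 < phi k)%R ->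
  sigma%:E < limn_einf (fun k => (- ln (phi k) / k%:R)%:E) ->
  exists K, forall k, (K <= k)%N -> (phi k <= expR (- sigma * k%:R))%R.
Proof.
move=> phi0 /lt_limn_einfP[K KP]; exists K.+1 => k Kk.
have k0 : (0 < k%:R :> R)%R by rewrite ltr0n (leq_trans _ Kk).
have := KP k (ltnW Kk); rewrite lte_fin => phik.
rewrite -[leLHS]lnK ?posrE// ler_expR mulNr lerNr ltW//.
by rewrite -ltr_pdivlMr.
Qed.

End LowerOrder.

(** * Optimising the rates *)

Section EntropyFactor.
Context {R : realType}.
Implicit Types (l h q : R) (tau E : \bar R).

Lemma entropy_factorP l h tau : 0 < l -> (0 <= tau)%E ->
  exists2 q : R, (l%:E / (l%:E + tau) * h%:E = q%:E)%E &
    (exists2 t, tau = t%:E & 0 <= t /\ q = l / (l + t) * h) \/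
    (tau = +oo%E /\ q = 0).
Proof.
move=> l0; case: tau => [t| |//] tau0; last first.
  by exists 0; [rewrite addey// invey mule0 mul0e|right].
rewrite lee_fin in tau0; have lt0 : 0 < l + t by rewrite ltr_pwDl.
exists (l / (l + t) * h); last by left; exists t.
by rewrite -EFinD inver gt_eqF// -!EFinM.
Qed.

(** For finite [tau = t], the rates [a = l - d] and [sigma = t + d] keep the sum [l + t], so the
    bound obtained is exactly [(l - d) * h / (l + t)], and [d] is arbitrarily small. *)
Lemma entropy_factor_le l h tau E : 0 < l -> 0 < h -> (0 <= tau)%E -> (0 <= E)%E ->
  (forall a sigma s, 0 < a -> a < l -> 0 <= sigma -> (tau < sigma%:E)%E ->
     s * (1 + sigma / a) <= h -> (s%:E <= E)%E) ->
  (l%:E / (l%:E + tau) * h%:E <= E)%E.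
Proof.
move=> l0 h0 tau0 E0 EP.
have [q -> [[t tauE [t0 ->]]|[_ ->]]] := entropy_factorP h l0 tau0; last exact: E0.
have lt0 : 0 < l + t by rewrite ltr_pwDl.
apply/lee_subgt0Pr => e e0; rewrite -EFinB.
pose d := Num.min (l / 2) (e * (l + t) / h).
have d0 : 0 < d by rewrite lt_min divr_gt0// divr_gt0// mulr_gt0.
have dl : d < l.
  by apply: (@le_lt_trans _ _ (l / 2)); [rewrite ge_min lexx|rewrite ltr_pdivrMr// ltr_pMr// ltr1n].
have dh : d * h / (l + t) <= e.
  by rewrite ler_pdivrMr// -ler_pdivlMr// ge_min lexx orbT.
apply: le_trans (_ : ((l - d) * h / (l + t))%:E <= _)%E.
  rewrite lee_fin mulrBl mulrBl (_ : l / (l + t) * h = l * h / (l + t)); last by rewrite mulrAC.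
  by rewrite lerD2l lerN2.
have ld0 : 0 < l - d by rewrite subr_gt0.
apply: (EP (l - d) (t + d)) => //.
- by rewrite gtrBl.
- by rewrite addr_ge0// ltW.
- by rewrite tauE lte_fin ltrDl.
- rewrite le_eqVlt; apply/orP; left; apply/eqP; field.
  by rewrite !gt_eqF.
Qed.

(** For finite positive [tau = t], the rates [l + d] and [t - d] again keep the sum. For [t = 0] no
    positive [sigma] is available and the first bound is used; for infinite [tau], a large [sigma]
    brings the bound down to any [e]. *)
Lemma entropy_factor_ge l h tau E : 0 < l -> 0 < h -> (0 <= tau)%E ->
  (forall s, h < s -> (E <= s%:E)%E) ->
  (forall b sigma s, l < b -> 0 < sigma -> (sigma%:E < tau)%E -> 0 <= s ->
     h < s * (1 + sigma / b) -> (E <= s%:E)%E) ->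
  (E <= l%:E / (l%:E + tau) * h%:E)%E.
Proof.
move=> l0 h0 tau0 Eh EP.
have [q -> qP] := entropy_factorP h l0 tau0.
apply/lee_addgt0Pr => e e0; rewrite -EFinD.
case: qP => [[t tauE [t0 ->]]|[tauE ->]].
  have lt0 : 0 < l + t by rewrite ltr_pwDl.
  have [t_eq0|tn0] := eqVneq t 0.
    by apply: Eh; rewrite t_eq0 addr0 divff ?gt_eqF// mul1r ltrDl.
  have tp : 0 < t by rewrite lt_neqAle eq_sym tn0.
  pose d := Num.min (t / 2) (e * (l + t) / h / 2).
  have d0 : 0 < d by rewrite lt_min !divr_gt0// mulr_gt0.
  have dt : d < t.
    by apply: (@le_lt_trans _ _ (t / 2)); [rewrite ge_min lexx|rewrite ltr_pdivrMr// ltr_pMr// ltr1n].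
  have dh : d * h / (l + t) < e.
    rewrite ltr_pdivrMr// -ltr_pdivlMr//; apply: le_lt_trans (_ : e * (l + t) / h / 2 < _).
      by rewrite ge_min lexx orbT.
    by rewrite ltr_pdivrMr// ltr_pMr ?ltr1n// divr_gt0// mulr_gt0.
  have ld0 : 0 < l + d by rewrite addr_gt0.
  have td0 : 0 < t - d by rewrite subr_gt0.
  apply: (EP (l + d) (t - d)) => //.
  - by rewrite ltrDl.
  - by rewrite tauE lte_fin gtrBl.
  - by rewrite addr_ge0 ?(ltW e0)// !mulr_ge0// ?invr_ge0 ltW.
  - apply: le_lt_trans (_ : ((l + d) * h / (l + t)) * (1 + (t - d) / (l + d)) < _).
      by rewrite le_eqVlt; apply/orP; left; apply/eqP; field; rewrite !gt_eqF.
    rewrite ltr_pM2r; last by rewrite addr_gt0// divr_gt0.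
    rewrite mulrDl mulrDl (_ : l / (l + t) * h = l * h / (l + t)); last by rewrite mulrAC.
    by rewrite ltrD2l.
rewrite add0r; pose sigma := (l + 1) * h / e.
have l1 : 0 < l + 1 by rewrite addr_gt0.
have sg0 : 0 < sigma by rewrite divr_gt0// mulr_gt0.
apply: (EP (l + 1) sigma) => //.
- by rewrite ltrDl.
- by rewrite tauE ltry.
- exact: ltW.
- rewrite (_ : e * _ = e + h); first by rewrite ltrDr.
  by rewrite /sigma; field; rewrite !gt_eqF.
Qed.

Lemma dim_le_of_entropy l q E (Dm : \bar R) : 0 < l -> 0 <= q -> (E <= q%:E)%E ->
  (forall a s, 0 < a -> a < l -> (E < s%:E)%E -> (Dm <= (s / a)%:E)%E) ->
  (Dm <= (q / l)%:E)%E.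
Proof.
move=> l0 q0 Eq DP; apply/lee_addgt0Pr => e e0; rewrite -EFinD.
pose w := q / l + e.
have w0 : 0 < w by rewrite ltr_wpDl// divr_ge0// ltW.
pose d := Num.min (l / 2) (e * l / w / 2).
have d0 : 0 < d by rewrite lt_min !divr_gt0// mulr_gt0.
have dl : d < l.
  by apply: (@le_lt_trans _ _ (l / 2)); [rewrite ge_min lexx|rewrite ltr_pdivrMr// ltr_pMr// ltr1n].
have dw : d * w < e * l.
  rewrite -ltr_pdivlMr//; apply: le_lt_trans (_ : e * l / w / 2 < _).
    by rewrite ge_min lexx orbT.
  by rewrite ltr_pdivrMr// ltr_pMr ?ltr1n// divr_gt0// mulr_gt0.
have ld0 : 0 < l - d by rewrite subr_gt0.
have := DP (l - d) ((l - d) * w) ld0; rewrite gtrBl d0 => /(_ isT).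
rewrite mulrAC divff ?gt_eqF// mul1r; apply.
apply: le_lt_trans Eq _; rewrite lte_fin mulrBl.
have -> : l * w = q + e * l by rewrite /w; field; rewrite gt_eqF.
by move: dw; lra.
Qed.

Lemma le_dim_of_entropy l q E (Dm : \bar R) : 0 < l -> (q%:E <= E)%E -> (0 <= Dm)%E ->
  (forall b t, l < b -> (Dm < t%:E)%E -> (E <= (b * t)%:E)%E) ->
  ((q / l)%:E <= Dm)%E.
Proof.
move=> l0 qE; case: Dm => [d| |//] d0 DP; last by rewrite leey.
rewrite lee_fin in d0; rewrite lee_fin ler_pdivrMr//; apply/ler_addgt0Pr => e e0.
(* Both [l] and [d] are raised by [x]; since [x < 1], the product grows by
   [x * (d + l + x) <= e]. *)
pose x := e / (d + l + 1 + e).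
have y0 : 0 < d + l + 1 + e by lra.
have x0 : 0 < x by rewrite divr_gt0.
have x1 : x < 1 by rewrite ltr_pdivrMr// mul1r; lra.
have := DP (l + x) (d + x); rewrite ltrDl x0 lte_fin ltrDl x0 => /(_ isT isT).
move=> /(le_trans qE); rewrite lee_fin => /le_trans; apply.
have xE : x * (d + l + 1 + e) = e by rewrite divfK// gt_eqF.
rewrite mulrDl !mulrDr [l * d]mulrC -addrA lerD2l -[leRHS]xE.
rewrite [l * x]mulrC -!mulrDr ler_pM2l//; lra.
Qed.

End EntropyFactor.

(** * Contraction and expansion rates from the spectrum *)

Section SpectralRates.
Context {R : realType} {n : nat}.
Context (A : 'M[int]_n.+1) (lam : 'I_n.+1 -> R[i]).
Context (charA : char_poly (map_mx intr A) = \prod_i ('X - (lam i)%:P)).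

Let spectrum := [seq lam i | i <- enum 'I_n.+1].

Let char_annihilates :
  horner_mx (map_mx (real_complex R) (map_mx (intr : int -> R) A))
    (\prod_(x <- spectrum) ('X - x%:P)) = 0.
Proof.
have -> : map_mx (real_complex R) (map_mx (intr : int -> R) A) = map_mx intr A.
  by apply/matrixP => i j; rewrite !mxE rmorph_int.
by rewrite big_map big_enum -charA Cayley_Hamilton.
Qed.

Lemma torus_endo_expanding_rate b : (forall i, normc (lam i) < expR b) ->
  exists2 C, 0 < C & forward_expanding (torus_endo A : torus R n.+1 -> _) b C.
Proof.
move=> lb; have [|C C0 CP] := enorm_powers_le (expR_gt0 b) _ char_annihilates.
  by move=> _ /mapP[i _ ->].
by exists C => //; exact: torus_endo_forward.
Qed.

Lemma torus_endo_contracting_rate a : \det A != 0 ->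
  (forall i, expR a < normc (lam i)) ->
  exists2 C, 0 < C & backward_contracting (torus_endo A : torus R n.+1 -> _) a C.
Proof.
move=> A0 al; have uA : map_mx (intr : int -> R) A \in unitmx := unitmx_intr A0.
have [||C C0 CP] := enorm_inv_powers_le uA (expR_gt0 (- a)) _ _ char_annihilates.
- move=> _ /mapP[i _ ->]; apply/eqP => l0; move: (al i); rewrite l0 normc0.
  by rewrite ltNge expR_ge0.
- move=> _ /mapP[i _ ->]; rewrite normcV expRN ltf_pV2 ?posrE ?expR_gt0//.
  exact: lt_trans (expR_gt0 _) (al i).
by exists C => //; exact: torus_endo_backward.
Qed.

End SpectralRates.

Theorem theorem1p15 (R : realType) (n : nat) (A : 'M[int]_n.+1)
    (lam : 'I_n.+1 -> R[i])
    (phi : nat -> nat -> R) (z : nat -> nat -> torus R n.+1) :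
  \det A != 0 ->
  char_poly (map_mx intr A) = \prod_(i < n.+1) ('X - (lam i)%:P) ->
  (forall i j : 'I_n.+1, (i <= j)%N -> normc (lam i) <= normc (lam j)) ->
  1 < normc (lam ord0) ->
  (forall j k, (1 <= j)%N -> 0 < phi j k <= 1) ->
  let l1 := ln (normc (lam ord0)) in
  let ld := ln (normc (lam ord_max)) in
  let h := \sum_(i < n.+1) ln (normc (lam i)) in
  let tau := ereal_sup
    [set limn_einf (fun k => (- ln (phi j k) / k%:R)%:E)
      | j in [set j | (1 <= j)%N]] in
  let S := \bigcap_(j in [set j | (1 <= j)%N])
    shrinking_target (torus_endo A) (phi j) (z j) in
  [/\ S !=set0,
      (l1%:E / (l1%:E + tau) * h%:E <= htop (torus_endo A) S
        <= ld%:E / (ld%:E + tau) * h%:E)%E,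
      ((1 / ld)%:E * (l1%:E / (l1%:E + tau)) * h%:E <= hausdorff_dim S
        <= (1 / l1)%:E * (ld%:E / (ld%:E + tau)) * h%:E)%E &
      normc (lam ord0) = normc (lam ord_max) ->
        htop (torus_endo A) S
          = (n.+1%:R%:E * ((ld ^+ 2)%:E / (ld%:E + tau)))%E /\
        hausdorff_dim S = (n.+1%:R%:E * (ld%:E / (ld%:E + tau)))%E].
Proof.
move=> A0 charA sorted lam1 phiP l1 ld h tau S.
have lam_gt1 i : 1 < normc (lam i) by apply: lt_le_trans lam1 (sorted _ _ _).
have lam_gt0 i : 0 < normc (lam i) by exact: lt_trans (lam_gt1 i).
have l1_gt0 : 0 < l1 by rewrite ln_gt0.
have ld_gt0 : 0 < ld by rewrite ln_gt0.
have h_gt0 : 0 < h.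
  rewrite /h (bigD1 ord0)//= ltr_pwDl//.
  by apply: sumr_ge0 => i _; rewrite ltW// ln_gt0.
pose f : torus R n.+1 -> torus R n.+1 := torus_endo A.
pose D := `|\det A|%N.
pose x0 : torus R n.+1 := 0.
have D_gt0 : (0 < D)%N by rewrite lt0n absz_eq0.
have hD : h = ln D%:R by rewrite (ln_absz_det charA).
have f_deg : has_degree f D := torus_endo_degree A0.
have [delta delta0 f_inj] := @torus_endo_injective_at_scale R n A A0.
have [r0 r00 Xr0] := @torus_bounded R n.
have Xc := @torus_complete R n.
have forw b : ld < b -> exists2 C, 0 < C & forward_expanding f b C.
  move=> lb; apply: (torus_endo_expanding_rate charA) => i.
  apply: le_lt_trans (sorted i ord_max _) _; first by rewrite -ltnS.
  by rewrite -[ltLHS]lnK ?posrE// ltr_expR.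
have back a : a < l1 -> exists2 C, 0 < C & backward_contracting f a C.
  move=> al; apply: (torus_endo_contracting_rate charA A0) => i.
  apply: lt_le_trans (sorted ord0 i _) => //.
  by rewrite -[ltRHS]lnK ?posrE// ltr_expR.
have phi0 j k : (1 <= j)%N -> 0 < phi j k by move=> j1; have /andP[] := phiP j k j1.
have tau0 : (0 <= tau)%E.
  apply: le_trans (_ : limn_einf (fun k => (- ln (phi 1%N k) / k%:R)%:E) <= _)%E.
    apply: limn_einf_ge0 => k; rewrite lee_fin divr_ge0// oppr_ge0 ln_le0//.
    by have /andP[] := phiP 1%N k isT.
  by apply: ereal_sup_ubound; exists 1%N.
have l12 : l1 / 2 < l1 by rewrite ltr_pdivrMr// ltr_pMr// ltr1n.
have l120 : 0 < l1 / 2 by rewrite divr_gt0.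
(* These two fixed rates serve wherever the value of the rate does not enter the bound; optimal
   bounds use rates approaching [l1] and [ld]. *)
have [Ca Ca0 f_back] := back (l1 / 2) l12.
have [Cb Cb0 f_forw] := forw (ld + 1) ltac:(by rewrite ltrDl).
have S0 : S !=set0.
  exact: (shrinking_targets_neq0 x0 D_gt0 f_deg delta0 l120 Ca0 r00 f_back Xr0 Cb0 f_forw Xc z phi0).
have lower : (l1%:E / (l1%:E + tau) * h%:E <= htop f S)%E.
  apply: entropy_factor_le => //; first exact: htop_ge0.
  move=> a sigma s a0 al sg0 tsg sh; have [C C0 fC] := back a al.
  apply: (htop_shrinking_targets_ge x0 D_gt0 f_deg delta0 f_inj a0 C0 r00 fC Xr0 Cb0 f_forw Xc z sg0); last by rewrite -hD.
  move=> j K j1; apply: order_lt_frequently; first by move=> k; exact: phi0.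
  by apply: le_lt_trans tsg; apply: ereal_sup_ubound; exists j.
have upper : (htop f S <= ld%:E / (ld%:E + tau) * h%:E)%E.
  apply: entropy_factor_ge => // [s hs|b sigma s lb sg0 sgt s0 hs].
    apply: (htop_le_ln_degree x0 S D_gt0 f_deg l120 Ca0 f_back r00 Xr0).
    by rewrite -hD.
  have [C C0 fC] := forw b lb.
  have /ereal_sup_gt[_ [j j1 <-] /order_gt_eventually[|K KP]] := sgt.
    by move=> k; exact: phi0.
  apply: (htop_shrinking_le x0 D_gt0 f_deg l120 Ca0 f_back (lt_trans ld_gt0 lb) C0 fC sg0 _ KP s0).
    by move=> x Sx; exact: Sx j1.
  by rewrite -hD.
have [q1 q1E _] := entropy_factorP h l1_gt0 tau0.
have [qd qdE qdP] := entropy_factorP h ld_gt0 tau0.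
have qd0 : 0 <= qd.
  by rewrite -lee_fin -qdE; apply: le_trans (htop_ge0 f S) upper.
have dim_lower : ((q1 / ld)%:E <= hausdorff_dim S)%E.
  apply: (le_dim_of_entropy (E := htop f S)) => //; first by rewrite -q1E.
    exact: hausdorff_dim_ge0.
  move=> b t lb; have [C C0 fC] := forw b lb.
  exact: (htop_le_hausdorff_dim x0 (lt_trans ld_gt0 lb) C0 fC).
have dim_upper : (hausdorff_dim S <= (qd / l1)%:E)%E.
  apply: (dim_le_of_entropy (E := htop f S)) => //; first by rewrite -qdE.
  move=> a s a0 al; have [C C0 fC] := back a al.
  have [eps [K [e0 K0 contr]]] := bowen_ball_contracting delta0 f_inj a0 C0 r00 fC Xr0.
  exact: (hausdorff_dim_le_htop a0 e0 K0 contr).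
have dimE (x y q : R) : (x%:E / (x%:E + tau) * h%:E = q%:E)%E ->
    ((1 / y)%:E * (x%:E / (x%:E + tau)) * h%:E)%E = (q / y)%:E.
  by move=> xq; rewrite -muleA xq -EFinM mul1r mulrC.
split=> //; first by rewrite lower upper.
  by rewrite (dimE _ _ _ q1E) (dimE _ _ _ qdE) dim_lower dim_upper.
move=> lE; have l1d : l1 = ld by rewrite /l1 lE.
have hE : h = n.+1%:R * ld.
  rewrite /h (eq_bigr (fun=> ld)) => [|i _].
    by rewrite sumr_const card_ord mulr_natl.
  congr ln; apply: le_anti.
  rewrite (sorted i ord_max (leq_ord i)) -[X in _ && (X <= _)]lE.
  exact: (sorted ord0 i (leq0n i)).
have q1d : q1 = qd by move: q1E; rewrite l1d qdE => -[].
have htopE : htop f S = qd%:E.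
  by apply/eqP; rewrite eq_le -qdE upper -l1d lower.
have dimSE : hausdorff_dim S = (qd / ld)%:E.
  by apply/eqP; rewrite eq_le -{1}l1d dim_upper -q1d dim_lower.
rewrite htopE dimSE; case: qdP => [[t -> [t0 ->]]|[-> ->]].
  have ldt : 0 < ld + t by rewrite ltr_pwDl.
  rewrite -EFinD inver gt_eqF// -!EFinM hE; split; congr EFin; field.
    by rewrite gt_eqF.
  by rewrite !gt_eqF.
by rewrite addey// invey !mule0 mul0r.
Qed.
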